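(* Let $\widetilde{\mathcal{SF}}(1)$ be the vertex superalgebra generated by the local fields $\varphi^+(z),\varphi^-(z)$ acting on $\overline F$. Then: (1) $\widetilde{\mathcal{SF}}(1)$ is isomorphic to the symplectic fermion vertex superalgebra $\mathcal{SF}(1)$. (2) The vertex superalgebra $\overline F$ has the structure of an irreducible $\mathcal{SF}(1)$-module $(\overline F,\mathcal Y^{\mathcal{SF}(1)}_{\overline F}(\cdot,z))$, uniquely determined by $\mathcal Y^{\mathcal{SF}(1)}_{\overline F}(a^{\pm},z)=\varphi^{\pm}(z)$. The action of the Virasoro field is $\mathcal Y^{\mathcal{SF}(1)}_{\overline F}(\omega_{sf},z)=L(z)$. (3) The vertex superalgebra $\mathcal{SF}(1)$ has the structure of an irreducible $\overline F$-module $(\mathcal{SF}(1),\mathcal Y^{\overline F}_{\mathcal{SF}(1)}(\cdot,z))$, determined by $$\mathcal Y^{\overline F}_{\mathcal{SF}(1)}(\Phi_1,z)=\tfrac1{\sqrt2}\big(a^+(z)-2z\,a^-(z)\big),$$ $$\mathcal Y^{\overline F}_{\mathcal{SF}(1)}(D\Phi_2,z)=-\sqrt{-2}\,a^-(z)+\tfrac{\sqrt{-1}}{\sqrt2}\,\partial_z\big(a^+(z)-2z\,a^-(z)\big).$$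
   Context: Everything is over $\mathbb C$. $F$ is the Clifford vertex superalgebra generated by odd fields $\Phi_i(z)=\sum_{r\in\frac12+\mathbb Z}\Phi_i(r)z^{-r-1/2}$, $i=1,2$, with $[\Phi_i(r),\Phi_j(s)]_+=\delta_{r+s,0}\delta_{i,j}$; $D$ is its canonical derivation. $\Psi^{\pm}=\frac1{\sqrt2}(\Phi_1\pm\sqrt{-1}\,\Phi_2)$. $\overline F=\mathrm{Ker}_F\Phi_2(\tfrac12)=\bigwedge(\Phi_1(-r+\tfrac12),\Phi_2(-r-\tfrac12)\mid r\in\mathbb Z_{>0})$, a vertex subalgebra of $F$. $\mathcal{SF}(1)=\mathrm{Ker}_F\Psi^-(\tfrac12)$ (i.e. the kernel of $\int\Psi^-(z)dz$), a vertex superalgebra freely generated by $a^+=\Psi^-$ and $a^-=D\Psi^+$; writing $a^\pm(z)=\sum_{n}a^\pm(n)z^{-n-1}$, one has $[a^\pm(n),a^\pm(m)]_+=0$, $[a^+(n),a^-(m)]_+=n\delta_{n+m,0}$. Its conformal vector is $\omega_{sf}=D\Psi^+\Psi^-=\Psi^+(-\tfrac32)\Psi^-(-\tfrac12){\bf 1}$, of central charge $-2$. On $\overline F$ put $\varphi^-(n)=-\frac n{\sqrt2}(\Phi_1(n-\tfrac12)+\sqrt{-1}\Phi_2(n-\tfrac12))$, $\varphi^+(n)=-\sqrt2(n\Phi_1(n+\tfrac12)+\sqrt{-1}(n+1)\Phi_2(n+\tfrac12))$, $\varphi^\pm(z)=\sum_{n\in\mathbb Z}\varphi^\pm(n)z^{-n-1}$;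 equivalently $\varphi^+(z)=\sqrt2\,z(\partial_z\Phi_1(z)+\sqrt{-1}\,\partial_z\Phi_2(z))+\sqrt2\,\Phi_1(z)$ and $\varphi^-(z)=\frac{1}{\sqrt2}(\partial_z\Phi_1(z)+\sqrt{-1}\,\partial_z\Phi_2(z))$. $L(z)=Y(\omega,z)$, where $\omega=\sqrt{-1}\,\Phi_2(-\tfrac32)\Phi_1(-\tfrac12){\bf 1}+\Phi_1(-\tfrac32)\Phi_1(-\tfrac12){\bf 1}\in\overline F$. Here $\sqrt{-2}=\sqrt2\sqrt{-1}$. *)

(* Defs.v *)
From HB Require Import structures.
From mathcomp Require Import all_boot all_order all_algebra.
From mathcomp Require Import classical_sets cardinality fsbigop.
Set Implicit Arguments.
Unset Strict Implicit.
Unset Printing Implicit Defensive.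
Import Order.TTheory GRing.Theory Num.Theory.
Local Open Scope ring_scope.

(* Superspaces: vector spaces V = V_0 (+) V_1.  [par p v] says v \in V_p, with
   [false] for even and [true] for odd.                                       *)

Definition is_subspace (C : fieldType) (V : lmodType C) (U : V -> Prop) :=
  U 0 /\ forall (c : C) (u v : V), U u -> U v -> U (c *: u + v).

Record superSpace (C : fieldType) := SuperSpace {
  ss_car :> lmodType C;
  par : bool -> ss_car -> Prop;
  par_subspace : forall p, is_subspace (par p);
  par_decomp : forall v, exists v0 v1, [/\ par false v0, par true v1 & v = v0 + v1];
  par_disjoint : forall v, par false v -> par true v -> v = 0 }.
Arguments par {C V} p v : rename.

(* A [modes M] stands for a formal series A(z) = \sum_n A_(n) z^(-n-1) of maps
   from M to M, given by n |-> A_(n).                                         *)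

Definition modes (M : Type) := int -> M -> M.

Section Fields.
Variables (C : fieldType) (M : superSpace C).
Implicit Types (A B : modes M) (p q : bool).

(* The generalized binomial coefficient C(n, j) for n an integer. *)
Definition binz (n : int) (j : nat) : C :=
  (\prod_(i < j) (n - i%:Z)%:~R) / (j`!)%:R.

Definition psign p q : C := (-1) ^+ (p && q).

(* z A(z) and the derivative of A(z). *)
Definition mulz A : modes M := fun n v => A (n + 1) v.
Definition derz A : modes M := fun n v => (- n)%:~R *: A (n - 1) v.

Definition id_field : modes M := fun n v => if n == -1 then v else 0.

Definition is_field p A :=
  [/\ forall n (c : C) u v, A n (c *: u + v) = c *: A n u + A n v,
      forall q n v, par q v -> par (p (+) q) (A n v) &
      forall v, exists N : int, forall n, N <= n -> A n v = 0].

(* (z - w)^N (A(z) B(w) - (-1)^(pq) B(w) A(z)) = 0 for some N, where A has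
   parity p and B has parity q; this is the coefficient of z^(-m-1) w^(-n-1). *)
Definition mutually_local p q A B := exists N : nat, forall m n v,
  \sum_(j < N.+1) ((-1) ^+ j * ('C(N, j))%:R) *:
     (A (m + (N - j)%N%:Z) (B (n + j%:Z) v)
      - psign p q *: B (n + j%:Z) (A (m + (N - j)%N%:Z) v)) = 0.

(* The n-th product A(w)_(n) B(w) of fields of respective parities p and q,
   i.e. Res_z (i_{z,w}(z-w)^n A(z)B(w) - (-1)^(pq) i_{w,z}(z-w)^n B(w)A(z)).
   On fields the sum over j has finite support. *)
Definition nprod p q (n : int) A B : modes M := fun k v =>
  \sum_(j \in [set: nat]) ((-1) ^+ j * binz n j) *:
     (A (n - j%:Z) (B (k + j%:Z) v)
      - ((-1) ^ n * psign p q) *: B (n + k - j%:Z) (A j%:Z v)).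

(* [gen_fields S p] is the parity-p part of the smallest graded space of fields
   that contains the identity field and S and is closed under all n-th products
   (hence under derivation, which is A |-> A_(-2) Id). *)
Inductive gen_fields (S : bool -> modes M -> Prop) : bool -> modes M -> Prop :=
| gen_fields_id : gen_fields S false id_field
| gen_fields_in p A : S p A -> gen_fields S p A
| gen_fields_lin p (c : C) A B : gen_fields S p A -> gen_fields S p B ->
    gen_fields S p (fun n v => c *: A n v + B n v)
| gen_fields_nprod p q n A B : gen_fields S p A -> gen_fields S q B ->
    gen_fields S (p (+) q) (nprod p q n A B).

End Fields.
Arguments id_field {C M}.

(* Borcherds identity, for products [Y a n b] = a_(n) b on V, and operators
   [YM a n] = a_(n) on M.  All sums have finite support as soon as Y and YM
   are truncated. *)
Definition borcherds (C : fieldType) (V M : superSpace C)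
    (Y : V -> modes V) (YM : V -> modes M) :=
  forall p q (a b : V), par p a -> par q b -> forall (m n k : int) (v : M),
    \sum_(j \in [set: nat]) binz C m j *: YM (Y a (n + j%:Z) b) (m + k - j%:Z) v
    = \sum_(j \in [set: nat]) ((-1) ^+ j * binz C n j) *:
        (YM a (m + n - j%:Z) (YM b (k + j%:Z) v)
         - ((-1) ^ n * psign C p q) *:
             YM b (n + k - j%:Z) (YM a (m + j%:Z) v)).

Record vertexSuperalgebra (C : fieldType) := VertexSuperalgebra {
  vsa_car :> superSpace C;
  vac : vsa_car;
  Yn : vsa_car -> modes vsa_car;
  vac_even : par false vac;
  Yn_linl : forall n v (c : C) a b, Yn (c *: a + b) n v = c *: Yn a n v + Yn b n v;
  Yn_field : forall p a, par p a -> is_field p (Yn a);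
  Yn_vac : forall n v, Yn vac n v = id_field n v;
  Yn_creation : forall a (n : int), -1 <= n -> Yn a n vac = if n == -1 then a else 0;
  Yn_borcherds : borcherds Yn Yn }.
Arguments vac {C V} : rename.
Arguments Yn {C V} a n b : rename.

Section VertexSuperalgebras.
Variable C : fieldType.
Implicit Types V W : vertexSuperalgebra C.

(* The canonical derivation. *)
Definition Dop V (a : V) : V := Yn a (-2) vac.

Definition is_vertex_subalgebra V (U : V -> Prop) :=
  [/\ is_subspace U, U vac & forall a b n, U a -> U b -> U (Yn a n b)].

Definition generated_by V (S : V -> Prop) :=
  forall U : V -> Prop, is_vertex_subalgebra U -> (forall a, S a -> U a) ->
  forall v, U v.

Definition is_vsa_iso V W (f : V -> W) :=
  [/\ bijective f,
      forall (c : C) a b, f (c *: a + b) = c *: f a + f b,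
      forall p a, par p a -> par p (f a),
      f vac = vac &
      forall a n b, f (Yn a n b) = Yn (f a) n (f b)].

Definition vsa_isomorphic V W := exists f : V -> W, is_vsa_iso f.

(* [iota] identifies W with the vertex superalgebra generated by the set of
   fields S on M: the space spanned by [gen_fields S], with the n-th products
   of fields and the identity field as vacuum. *)
Definition is_generated_vsa (M : superSpace C) (S : bool -> modes M -> Prop)
    W (iota : W -> modes M) :=
  [/\ forall (c : C) a b n v,
        iota (c *: a + b) n v = c *: iota a n v + iota b n v,
      injective iota,
      forall p A, gen_fields S p A <-> exists2 a : W, par p a & iota a = A,
      iota vac = id_field &
      forall p q (a b : W) n, par p a -> par q b ->
        iota (Yn a n b) = nprod p q n (iota a) (iota b)].

Definition is_module V (M : superSpace C) (YM : V -> modes M) :=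
  [/\ forall n v (c : C) a b, YM (c *: a + b) n v = c *: YM a n v + YM b n v,
      forall p a, par p a -> is_field p (YM a),
      forall n v, YM vac n v = id_field n v &
      borcherds Yn YM].

Definition is_irreducible V (M : superSpace C) (YM : V -> modes M) :=
  (exists v : M, v <> 0) /\
  forall U : M -> Prop, is_subspace U ->
    (forall a n v, U v -> U (YM a n v)) ->
    (exists2 u, U u & u <> 0) -> forall v, U v.

End VertexSuperalgebras.

(* The kernel of a_(0) on V, for a odd, as a vertex subalgebra of V. *)
Section Kernel.
Variables (C : fieldType) (V : vertexSuperalgebra C).

Section Carrier.
Variable a : V.
Definition ker_pred : {pred V} := fun v => Yn a 0 v == 0.

Lemma Yn_linr (b : V) n (c : C) (u v : V) :
  Yn b n (c *: u + v) = c *: Yn b n u + Yn b n v.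
Proof.
have [b0 [b1 [h0 h1 ->]]] := par_decomp b.
rewrite -[b0]scale1r !Yn_linl !scale1r.
have [-> _ _] := Yn_field h0; have [-> _ _] := Yn_field h1.
by rewrite scalerDr addrACA.
Qed.

Lemma Yn0r (b : V) n : Yn b n 0 = 0.
Proof.
have := Yn_linr b n 1 0 0.
by rewrite !scale1r addr0 => /(congr1 (fun x => x - Yn b n 0)); rewrite subrr addrK.
Qed.

Lemma Yn0l n (v : V) : Yn 0 n v = 0.
Proof.
have := Yn_linl n v 1 0 0.
by rewrite !scale1r addr0 => /(congr1 (fun x => x - Yn 0 n v)); rewrite subrr addrK.
Qed.

Lemma ker_submod_closed : submod_closed ker_pred.
Proof.
split; first by rewrite unfold_in Yn0r.
by move=> c u v; rewrite !unfold_in Yn_linr => /eqP -> /eqP ->; rewrite scaler0 addr0.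
Qed.
HB.instance Definition _ := GRing.isSubmodClosed.Build C V ker_pred ker_submod_closed.

Definition ker_type := {v : V | v \in ker_pred}.
HB.instance Definition _ := SubType.on ker_type.
HB.instance Definition _ := Choice.on ker_type.
HB.instance Definition _ := [SubChoice_isSubLmodule of ker_type by <:].
End Carrier.

Lemma binz0 (j : nat) : binz C 0 j = (j == 0%N)%:R.
Proof.
rewrite /binz; case: j => [|j]; first by rewrite big_ord0 invr1 mulr1.
by rewrite big_ord_recl /= subr0 !mul0r.
Qed.

Lemma fsum0 (W : lmodType C) (F : nat -> W) :
  (forall j, F j.+1 = 0) -> \sum_(j \in [set: nat]) F j = F 0%N.
Proof.
move=> h; rewrite -(@fsbig_widen _ _ _ _ [set 0%N]) ?fsbig_set1//.
by move=> [|j] //= [_ /(_ erefl)].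
Qed.

Variables (a : V) (ha : par true a).
Local Notation K := (ker_type a).

Lemma par_lin p (c : C) (u v : V) : par p u -> par p v -> par p (c *: u + v).
Proof. by case: (par_subspace V p) => _; apply. Qed.

Lemma par0 p : par p (0 : V).
Proof. by case: (par_subspace V p). Qed.

Lemma a0_der q (b c : V) n : par q b ->
  Yn (Yn a 0 b) n c = Yn a 0 (Yn b n c) - psign C true q *: Yn b n (Yn a 0 c).
Proof.
move=> hb; have := Yn_borcherds ha hb 0 0 n c.
rewrite !fsum0; last first.
- by move=> j; rewrite binz0 scale0r.
- by move=> j; rewrite binz0 mulr0 scale0r.
rewrite !binz0 !expr0z !expr0 !mul1r !scale1r.
by rewrite !addr0 !add0r.
Qed.

Lemma ker_decomp (v : V) : v \in ker_pred a -> exists v0 v1,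
  [/\ par false v0, par true v1, v = v0 + v1, v0 \in ker_pred a & v1 \in ker_pred a].
Proof.
have [v0 [v1 [h0 h1 ->]]] := par_decomp v.
rewrite unfold_in => /eqP; rewrite -{1}[v0]scale1r Yn_linr scale1r => e.
have [_ hp _] := Yn_field ha.
have k1 : Yn a 0 v1 = 0.
  apply: par_disjoint; first exact: (hp true).
  have -> : Yn a 0 v1 = (-1) *: Yn a 0 v0 + 0.
    by rewrite addr0 scaleN1r; apply/eqP; rewrite -addr_eq0 addrC e.
  by apply: par_lin; [exact: (hp false) | exact: par0].
have k0 : Yn a 0 v0 = 0 by move: e; rewrite k1 addr0.
exists v0, v1; split => //; by rewrite unfold_in ?k0 ?k1.
Qed.

Lemma ker_closed (b c : V) n :
  b \in ker_pred a -> c \in ker_pred a -> Yn b n c \in ker_pred a.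
Proof.
move=> /ker_decomp[b0 [b1 [p0 p1 -> k0 k1]]] kc.
have h q d : par q d -> d \in ker_pred a -> Yn a 0 (Yn d n c) = 0.
  move=> hd; rewrite unfold_in => /eqP kd; move: (a0_der c n hd).
  move: kc; rewrite unfold_in => /eqP ->.
  by rewrite kd Yn0l Yn0r scaler0 subr0.
rewrite unfold_in -[b0]scale1r Yn_linl Yn_linr (h _ _ p0 k0) (h _ _ p1 k1).
by rewrite scaler0 addr0.
Qed.

Lemma ker_vac : vac \in ker_pred a.
Proof. by rewrite unfold_in Yn_creation. Qed.

Lemma ker_valP (c : C) (u v : K) : val (c *: u + v) = c *: val u + val v.
Proof. exact: (linearP (val : K -> V)). Qed.

Lemma ker_valZ (c : C) (u : K) : val (c *: u) = c *: val u.
Proof. by rewrite -[c *: u]addr0 ker_valP addr0. Qed.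

Lemma ker_valB (u v : K) : val (u - v) = val u - val v.
Proof. exact: (raddfB (val : K -> V)). Qed.

Definition ker_par p (v : K) := par p (val v).

Lemma ker_par_subspace p : is_subspace (ker_par p).
Proof.
split; first exact: par0.
by move=> c u v hu hv; rewrite /ker_par ker_valP; apply: par_lin.
Qed.

Lemma ker_par_decomp (v : K) :
  exists v0 v1, [/\ ker_par false v0, ker_par true v1 & v = v0 + v1].
Proof.
have [v0 [v1 [p0 p1 e k0 k1]]] := ker_decomp (valP v).
exists (Sub v0 k0), (Sub v1 k1); split; rewrite /ker_par ?SubK //.
by apply: val_inj; rewrite -[Sub v0 k0]scale1r ker_valP !SubK scale1r.
Qed.

Lemma ker_par_disjoint (v : K) : ker_par false v -> ker_par true v -> v = 0.
Proof. by move=> h0 h1; apply: val_inj; apply: par_disjoint. Qed.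

Definition ker_superSpace : superSpace C :=
  SuperSpace ker_par_subspace ker_par_decomp ker_par_disjoint.

Definition ker_Yn (b : K) : modes K := fun n c =>
  Sub (Yn (val b) n (val c)) (ker_closed n (valP b) (valP c)).

Lemma ker_Yn_linl n (v : K) (c : C) (b b' : K) :
  ker_Yn (c *: b + b') n v = c *: ker_Yn b n v + ker_Yn b' n v.
Proof. by apply: val_inj; rewrite [RHS]ker_valP !SubK Yn_linl. Qed.

Lemma ker_Yn_field p (b : ker_superSpace) : par p b -> is_field p (ker_Yn b : modes ker_superSpace).
Proof.
move=> hb; have [l h t] := Yn_field (hb : par p (val b)); split.
- by move=> n c u v; apply: val_inj; rewrite [RHS]ker_valP !SubK l.
- by move=> q n v hv; apply: h.
move=> v; have [N hN] := t (val v); exists N => n /hN e; exact: val_inj.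
Qed.

Lemma ker_Yn_vac n (v : K) :
  ker_Yn (Sub vac ker_vac) n v = @id_field C ker_superSpace n v.
Proof.
apply: val_inj; rewrite /= Yn_vac /id_field; by case: ifP.
Qed.

Lemma ker_Yn_creation (b : K) (n : int) : -1 <= n ->
  ker_Yn b n (Sub vac ker_vac) = if n == -1 then b else 0.
Proof. by move=> h; apply: val_inj; rewrite /= Yn_creation //; case: ifP. Qed.

Lemma val_fsum (F : nat -> K) :
  val (\sum_(j \in [set: nat]) F j) = \sum_(j \in [set: nat]) val (F j).
Proof.
have e : finite_support 0 [set: nat] (fun j => val (F j)) = finite_support 0 [set: nat] F.
  rewrite /finite_support; do 3!congr (_ _); apply/seteqP; split => j [_ h]; split => // h'; apply: h.
    by rewrite /= h'.
  exact: val_inj.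
rewrite e; exact: (raddf_sum (val : K -> V)).
Qed.

Lemma ker_Yn_borcherds :
  @borcherds C ker_superSpace ker_superSpace ker_Yn ker_Yn.
Proof.
move=> p q b c hb hc m n k v; apply: val_inj; rewrite !val_fsum.
have := Yn_borcherds (hb : par p (val b)) (hc : par q (val c)) m n k (val v).
move=> e; etransitivity; last (etransitivity; first exact: e).
  by apply: eq_fsbigr => j _; rewrite ker_valZ.
by apply: eq_fsbigr => j _; rewrite ker_valZ (ker_valB _ (_ *: _)) ker_valZ.
Qed.

Definition kerVSA : vertexSuperalgebra C :=
  @VertexSuperalgebra C ker_superSpace (Sub vac ker_vac) ker_Yn (vac_even V)
    ker_Yn_linl ker_Yn_field ker_Yn_vac ker_Yn_creation ker_Yn_borcherds.

End Kernel.

(* The Clifford vertex superalgebra on Phi_1, Phi_2.  As Phi_i(z) has conformal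
   weight 1/2, Phi_i(r) is the mode Yn (Phi i) (r - 1/2), i.e.
   Phi_i(n + 1/2) = Yn (Phi i) n.  The indices i = 1, 2 are shifted to 0, 1. *)
Record cliffordVSA (C : numClosedFieldType) := CliffordVSA {
  cl_vsa :> vertexSuperalgebra C;
  Phi : 'I_2 -> cl_vsa;
  Phi_nontrivial : vac <> 0 :> cl_vsa;
  Phi_odd : forall i, par true (Phi i);
  Phi_anticomm : forall i j m n (v : cl_vsa),
    Yn (Phi i) m (Yn (Phi j) n v) + Yn (Phi j) n (Yn (Phi i) m v)
    = if (m + n + 1 == 0) && (i == j) then v else 0;
  Phi_gen : generated_by (fun a => exists i, a = Phi i) }.

Section Clifford.
Variables (C : numClosedFieldType) (F : cliffordVSA C).

Definition Phi1 : F := Phi F 0.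
Definition Phi2 : F := Phi F 1.

Definition Psi_plus : F := (sqrtC 2)^-1 *: (Phi1 + 'i *: Phi2).
Definition Psi_minus : F := (sqrtC 2)^-1 *: (Phi1 - 'i *: Phi2).

Definition lin12 (x y : C) : F := x *: Phi1 + y *: Phi2.

Lemma lin12_mode x y n v :
  Yn (lin12 x y) n v = x *: Yn Phi1 n v + y *: Yn Phi2 n v.
Proof. by rewrite Yn_linl -[y *: _]addr0 Yn_linl Yn0l addr0. Qed.

Lemma lin12_anticomm x y z t m n v :
  Yn (lin12 x y) m (Yn (lin12 z t) n v) + Yn (lin12 z t) n (Yn (lin12 x y) m v)
  = if m + n + 1 == 0 then (x * z + y * t) *: v else 0.
Proof.
have YZ (b : F) k (c : C) u : Yn b k (c *: u) = c *: Yn b k u.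
  by rewrite -[_ *: u]addr0 Yn_linr Yn0r addr0.
rewrite !lin12_mode !Yn_linr !YZ !scalerDr !scalerA.
have e i j := Phi_anticomm (c := F) i j m n v.
move: (e 0 0) (e 0 1) (e 1 0) (e 1 1); rewrite -/Phi1 -/Phi2 !andbF !eqxx !andbT.
move=> e11 e12 e21 e22.
rewrite (mulrC z x) (mulrC z y) (mulrC t x) (mulrC t y).
transitivity (x * z *: (Yn Phi1 m (Yn Phi1 n v) + Yn Phi1 n (Yn Phi1 m v))
  + x * t *: (Yn Phi1 m (Yn Phi2 n v) + Yn Phi2 n (Yn Phi1 m v))
  + y * z *: (Yn Phi2 m (Yn Phi1 n v) + Yn Phi1 n (Yn Phi2 m v))
  + y * t *: (Yn Phi2 m (Yn Phi2 n v) + Yn Phi2 n (Yn Phi2 m v))).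
  rewrite !scalerDr !addrA.
  by rewrite (ACl (1*5*2*7*3*6*4*8))/=.
rewrite e11 e12 e21 e22; case: ifP => _; last by rewrite !scaler0 !addr0.
by rewrite !scaler0 !addr0 scalerDl.
Qed.

Lemma ker_step x y z t n (v : F) :
  v \in ker_pred (lin12 x y) -> (n = -1 -> x * z + y * t = 0) ->
  Yn (lin12 z t) n v \in ker_pred (lin12 x y).
Proof.
rewrite !unfold_in => /eqP kv h.
move: (lin12_anticomm x y z t 0 n v); rewrite kv Yn0r addr0 => ->.
by case: ifP => //; rewrite add0r addr_eq0 => /eqP /h ->; rewrite scale0r.
Qed.

Lemma Phi1E : Phi1 = lin12 1 0.
Proof. by rewrite /lin12 scale1r scale0r addr0. Qed.
Lemma Phi2E : Phi2 = lin12 0 1.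
Proof. by rewrite /lin12 scale1r scale0r add0r. Qed.
Lemma Psi_plusE : Psi_plus = lin12 (sqrtC 2)^-1 ((sqrtC 2)^-1 * 'i).
Proof. by rewrite /Psi_plus scalerDr scalerA. Qed.
Lemma Psi_minusE : Psi_minus = lin12 (sqrtC 2)^-1 (- ((sqrtC 2)^-1 * 'i)).
Proof. by rewrite /Psi_minus scalerBr scalerA /lin12 scaleNr. Qed.

Lemma modeE (a : F) : a = Yn a (-1) vac.
Proof. by rewrite Yn_creation. Qed.

Lemma Psi_minus_odd : par true Psi_minus.
Proof.
rewrite Psi_minusE; apply: par_lin; first exact: Phi_odd.
by rewrite -[_ *: _]addr0; apply: par_lin; [exact: Phi_odd | exact: par0].
Qed.

(* The modes of index 0 of Phi_2 and Psi^- are Phi_2(1/2) and Psi^-(1/2). *)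
Definition Fbar : vertexSuperalgebra C := kerVSA (Phi_odd F 1).

Definition SF : vertexSuperalgebra C := kerVSA Psi_minus_odd.

Lemma Psi_minus_minus n (v : F) : v \in ker_pred Psi_minus ->
  Yn Psi_minus n v \in ker_pred Psi_minus.
Proof.
rewrite Psi_minusE => kv; apply: ker_step => // _.
by rewrite mulrNN mulrACA -expr2 -expr2 sqrCi mulrN1 subrr.
Qed.

Lemma Psi_minus_plus n (v : F) : n != -1 -> v \in ker_pred Psi_minus ->
  Yn Psi_plus n v \in ker_pred Psi_minus.
Proof.
rewrite Psi_minusE Psi_plusE => hn kv; apply: ker_step => // e.
by rewrite e in hn.
Qed.

Lemma a_plus_subproof : Psi_minus \in ker_pred Psi_minus.
Proof. by rewrite {1}[Psi_minus]modeE Psi_minus_minus ?ker_vac ?Psi_minus_odd. Qed.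

Lemma a_minus_subproof : Dop Psi_plus \in ker_pred Psi_minus.
Proof. by rewrite Psi_minus_plus ?ker_vac ?Psi_minus_odd. Qed.

Lemma omega_sf_subproof :
  Yn Psi_plus (-2) (Yn Psi_minus (-1) vac) \in ker_pred Psi_minus.
Proof. by rewrite Psi_minus_plus ?Psi_minus_minus ?ker_vac ?Psi_minus_odd. Qed.

Definition a_plus : SF := Sub Psi_minus a_plus_subproof.
Definition a_minus : SF := Sub (Dop Psi_plus) a_minus_subproof.

(* Psi^+(-3/2) Psi^-(-1/2) 1 *)
Definition omega_sf : SF :=
  Sub (Yn Psi_plus (-2) (Yn Psi_minus (-1) vac)) omega_sf_subproof.

Lemma Phi2_lin x y n (v : F) : (n = -1 -> y = 0) -> v \in ker_pred Phi2 ->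
  Yn (lin12 x y) n v \in ker_pred Phi2.
Proof.
rewrite Phi2E => h kv; apply: ker_step => // /h ->.
by rewrite mul0r mulr0 addr0.
Qed.

Lemma Phi1_Fbar_subproof : Phi1 \in ker_pred Phi2.
Proof.
by rewrite [Phi1]modeE Phi1E Phi2_lin // ker_vac //; apply: Phi_odd.
Qed.

Lemma DPhi2_Fbar_subproof : Dop Phi2 \in ker_pred Phi2.
Proof.
by rewrite /Dop {1}Phi2E Phi2_lin // ker_vac //; apply: Phi_odd.
Qed.

Lemma omega_subproof :
  'i *: Yn Phi2 (-2) (Yn Phi1 (-1) vac) + Yn Phi1 (-2) (Yn Phi1 (-1) vac)
    \in ker_pred Phi2.
Proof.
have -> : 'i *: Yn Phi2 (-2) (Yn Phi1 (-1) vac) + Yn Phi1 (-2) (Yn Phi1 (-1) vac)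
  = Yn (lin12 1 'i) (-2) Phi1 by rewrite lin12_mode -modeE scale1r addrC.
by rewrite Phi2_lin // Phi1_Fbar_subproof.
Qed.

Definition Phi1_Fbar : Fbar := Sub Phi1 Phi1_Fbar_subproof.
Definition DPhi2_Fbar : Fbar := Sub (Dop Phi2) DPhi2_Fbar_subproof.

(* i Phi_2(-3/2) Phi_1(-1/2) 1 + Phi_1(-3/2) Phi_1(-1/2) 1 *)
Definition omega : Fbar :=
  Sub ('i *: Yn Phi2 (-2) (Yn Phi1 (-1) vac) + Yn Phi1 (-2) (Yn Phi1 (-1) vac))
    omega_subproof.

(* phi^-(n) = - n / sqrt 2 (Phi_1(n - 1/2) + i Phi_2(n - 1/2)) and
   phi^+(n) = - sqrt 2 (n Phi_1(n + 1/2) + i (n + 1) Phi_2(n + 1/2)) on F. *)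
Definition phi_minus_F : modes F := fun n v =>
  - (n%:~R / sqrtC 2) *: (Yn Phi1 (n - 1) v + 'i *: Yn Phi2 (n - 1) v).
Definition phi_plus_F : modes F := fun n v =>
  - sqrtC 2 *: (n%:~R *: Yn Phi1 n v + ('i * (n + 1)%:~R) *: Yn Phi2 n v).

Lemma phi_minus_subproof n (v : F) :
  v \in ker_pred Phi2 -> phi_minus_F n v \in ker_pred Phi2.
Proof.
move=> kv; rewrite /phi_minus_F scalerDr scalerA -lin12_mode Phi2_lin // => e.
have -> : n = 0 by rewrite -[n](subrK 1) e.
by rewrite mul0r oppr0 mul0r.
Qed.

Lemma phi_plus_subproof n (v : F) :
  v \in ker_pred Phi2 -> phi_plus_F n v \in ker_pred Phi2.
Proof.
move=> kv; rewrite /phi_plus_F scalerDr !scalerA -lin12_mode Phi2_lin // => ->.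
by rewrite addNr !mulr0.
Qed.

Definition phi_minus : modes Fbar := fun n v =>
  Sub (phi_minus_F n (val v)) (phi_minus_subproof n (valP v)).
Definition phi_plus : modes Fbar := fun n v =>
  Sub (phi_plus_F n (val v)) (phi_plus_subproof n (valP v)).

(* a^+(z) - 2 z a^-(z), acting on SF(1). *)
Definition a_comb : modes SF := fun n v =>
  Yn a_plus n v - 2 *: mulz (Yn a_minus) n v.

(* The set {phi^+, phi^-}, both of odd parity. *)
Definition phi_fields (p : bool) (A : modes Fbar) : Prop :=
  p = true /\ (A = phi_plus \/ A = phi_minus).

End Clifford.

(* Main.v *)
(** Let [u = Psi^+_(-2) Psi^+].  The operator [u_(1)] commutes with the modes of
    Psi^+, satisfies [[u_(1), Psi^-_(n)] = - (2 n + 1) Psi^+_(n)], kills the vacuum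
    and is therefore locally nilpotent on F.  Conjugation by [exp u_(1)] fixes
    Psi^+(z) and sends Psi^-(z) to Psi^-(z) + (2 z d/dz + 1) Psi^+(z) = phi^+(z);
    at mode 0 this turns Psi^-(1/2) into a multiple of Phi_2(1/2), so
    [exp u_(1)] maps SF(1) onto Fbar.  Both module structures of the theorem are
    the adjoint modules transported along this isomorphism, and the vertex
    superalgebra generated by phi^+, phi^- is the image of SF(1) acting on Fbar.
    Irreducibility and generation are proved for SF(1) from the Clifford
    relations on F and pulled back to Fbar. *)

Require Import Defs.
From mathcomp Require Import all_boot all_order all_algebra.
From mathcomp Require Import boolp classical_sets cardinality fsbigop.
From mathcomp Require Import reals complex.
From mathcomp Require Import zify ring.
Set Implicit Arguments.
Unset Strict Implicit.
Unset Printing Implicit Defensive.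
Import GRing.Theory Num.Theory.
Local Open Scope ring_scope.

(** * Superspaces, modules and generation *)

Section LinearMaps.
Variables (C : fieldType) (V W : lmodType C) (f : V -> W).
Hypothesis f_lin : forall (c : C) u v, f (c *: u + v) = c *: f u + f v.

Lemma linear_0 : f 0 = 0.
Proof. by have := f_lin (-1) 0 0; rewrite scaler0 addr0 scaleN1r addNr. Qed.

Lemma linear_scale c u : f (c *: u) = c *: f u.
Proof. by rewrite -[_ *: u]addr0 f_lin linear_0 addr0. Qed.

Lemma linear_add u v : f (u + v) = f u + f v.
Proof. by rewrite -[u in LHS]scale1r f_lin scale1r. Qed.

Lemma linear_sum n (F : 'I_n -> V) : f (\sum_(i < n) F i) = \sum_(i < n) f (F i).
Proof. exact: (big_morph f linear_add linear_0). Qed.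

End LinearMaps.

Section Subspaces.
Variables (C : fieldType) (V : lmodType C) (U : V -> Prop).
Hypothesis hU : is_subspace U.

Lemma subspaceD u v : U u -> U v -> U (u + v).
Proof. by case: hU => _ h hu hv; rewrite -[u]scale1r; apply: h. Qed.

Lemma subspaceZ c u : U u -> U (c *: u).
Proof. by case: hU => h0 h hu; rewrite -[_ *: u]addr0; apply: h. Qed.

Lemma subspaceN u : U u -> U (- u).
Proof. by rewrite -scaleN1r; apply: subspaceZ. Qed.

Lemma subspaceB u v : U u -> U v -> U (u - v).
Proof. by move=> hu hv; apply: subspaceD => //; apply: subspaceN. Qed.

Lemma subspace_fsum (f : nat -> V) :
  (forall j, U (f j)) -> U (\sum_(j \in [set: nat]) f j).
Proof.
by move=> h; apply: big_ind => //; [case: hU | apply: subspaceD].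
Qed.

End Subspaces.

(** * Finitely supported sums *)

Section FiniteSums.
Variables (C : fieldType) (V W : lmodType C).

Lemma fsum_trunc (N : nat) (f : nat -> V) :
  (forall j, (N <= j)%N -> f j = 0) ->
  \sum_(j \in [set: nat]) f j = \sum_(j < N) f j.
Proof.
move=> h; rewrite -(@fsbig_widen _ _ _ _ (`I_N)) ?fsbig_ord// => j [_ /=].
by move/negP; rewrite -leqNgt => /h ->.
Qed.

(** A sum with infinite support is 0 by convention, so the supports on both sides must coincide;
    injectivity of [f] ensures this. *)
Lemma raddf_fsum_inj (f : V -> W) (F : nat -> V) :
    (forall (c : C) u v, f (c *: u + v) = c *: f u + f v) -> injective f ->
  f (\sum_(j \in [set: nat]) F j) = \sum_(j \in [set: nat]) f (F j).
Proof.
move=> hf injf.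
have e : finite_support 0 [set: nat] (fun j => f (F j))
         = finite_support 0 [set: nat] F.
  rewrite /finite_support; do 3!congr (_ _); apply/seteqP.
  split => j [_ h]; split => // h'; apply: h; first by rewrite /= h' (linear_0 hf).
  by apply: injf; rewrite (linear_0 hf).
rewrite e; exact: (big_morph f (linear_add hf) (linear_0 hf)).
Qed.

End FiniteSums.

Lemma binz_nat_small (C : fieldType) (n j : nat) : (n < j)%N -> binz C n j = 0.
Proof.
move=> h; rewrite /binz (bigD1 (Ordinal h)) //= subrr !mul0r.
by [].
Qed.

Lemma binz_0 (C : fieldType) n : binz C n 0 = 1.
Proof. by rewrite /binz big_ord0 fact0 divr1. Qed.

Lemma binz_1 (C : fieldType) n : binz C n 1 = n%:~R.
Proof. by rewrite /binz big_ord1 subr0 factS fact0 muln1 divr1. Qed.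

(** * Consequences of Borcherds' identity in a module *)

Section Modules.
Variables (C : fieldType) (V : vertexSuperalgebra C) (M : superSpace C).
Variable Y : V -> modes M.
Hypothesis hY : is_module Y.

Lemma module_linl n v (c : C) a b :
  Y (c *: a + b) n v = c *: Y a n v + Y b n v.
Proof. by case: hY. Qed.

Lemma module_addl n v a b : Y (a + b) n v = Y a n v + Y b n v.
Proof. by rewrite -[a in LHS]scale1r module_linl scale1r. Qed.

Lemma module_0l n v : Y 0 n v = 0.
Proof.
by have := module_linl n v (-1) 0 0; rewrite scaler0 addr0 scaleN1r addNr.
Qed.

Lemma module_linr a n (c : C) u v :
  Y a n (c *: u + v) = c *: Y a n u + Y a n v.
Proof.
have [a0 [a1 [h0 h1 ->]]] := par_decomp a.
have [_ hf _ _] := hY; rewrite !module_addl.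
have [-> _ _] := hf _ _ h0; have [-> _ _] := hf _ _ h1.
by rewrite scalerDr addrACA.
Qed.

Lemma module_addr a n u v : Y a n (u + v) = Y a n u + Y a n v.
Proof. by rewrite -[u in LHS]scale1r module_linr scale1r. Qed.

Lemma module_0r a n : Y a n 0 = 0.
Proof.
by have := module_linr a n (-1) 0 0; rewrite scaler0 addr0 scaleN1r addNr.
Qed.

Lemma module_scaler a n (c : C) u : Y a n (c *: u) = c *: Y a n u.
Proof. by rewrite -[_ *: u]addr0 module_linr module_0r addr0. Qed.

(** Borcherds' identity at m = 0, where only j = 0 survives on the left. *)
Lemma module_nprod p q a b n k v : par p a -> par q b ->
  Y (Yn a n b) k v = nprod p q n (Y a) (Y b) k v.
Proof.
move=> pa pb; have [_ _ _ hB] := hY.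
have := hB _ _ _ _ pa pb 0 n k v.
rewrite fsum0 => [|j]; last by rewrite binz0 scale0r.
rewrite binz0 scale1r !addr0 add0r => ->.
by apply: eq_fsbigr => j _; rewrite !add0r.
Qed.

(** Borcherds' identity at n = 0, where only j = 0 survives on the right. *)
Lemma module_commutator p q a b m k v : par p a -> par q b ->
  Y a m (Y b k v) - psign C p q *: Y b k (Y a m v)
  = \sum_(j \in [set: nat]) binz C m j *: Y (Yn a j b) (m + k - j%:Z) v.
Proof.
move=> pa pb; have [_ _ _ hB] := hY.
have := hB _ _ _ _ pa pb m 0 k v.
rewrite [RHS]fsum0 => [|j]; last by rewrite binz0 mulr0 scale0r.
rewrite binz0 expr0 expr0z !mul1r scale1r !addr0 !add0r => <-.
by apply: eq_fsbigr => j _; rewrite add0r.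
Qed.

End Modules.

Lemma adjoint_module (C : fieldType) (V : vertexSuperalgebra C) :
  is_module (@Yn C V).
Proof.
split; [exact: Yn_linl | exact: Yn_field | exact: Yn_vac | exact: Yn_borcherds].
Qed.

(** * Transport of module structures along an isomorphism of superspaces *)

Section Transport.
Variables (C : fieldType) (V : vertexSuperalgebra C) (M N : superSpace C).
Variables (f : M -> N) (g : N -> M).
Hypothesis fP : forall (c : C) u v, f (c *: u + v) = c *: f u + f v.
Hypothesis gP : forall (c : C) u v, g (c *: u + v) = c *: g u + g v.
Hypothesis f_par : forall p v, par p v -> par p (f v).
Hypothesis g_par : forall p v, par p v -> par p (g v).
Hypothesis fK : cancel f g.
Hypothesis gK : cancel g f.

Definition transport (Y : V -> modes M) : V -> modes N :=
  fun a n v => f (Y a n (g v)).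

Lemma transport_module Y : is_module Y -> is_module (transport Y).
Proof.
move=> hY; have [hl hf hv hB] := hY; split.
- by move=> n v c a b; rewrite /transport hl fP.
- move=> p a pa; have [h1 h2 h3] := hf _ _ pa; split.
  + by move=> n c u v; rewrite /transport gP h1 fP.
  + by move=> q n v pv; apply/f_par/h2/g_par.
  + move=> v; have [k hk] := h3 (g v); exists k => n /hk e.
    by rewrite /transport e linear_0.
- move=> n v; rewrite /transport hv /id_field; case: ifP => _; first exact: gK.
  exact: linear_0.
- move=> p q a b pa pb m n k v.
  have e := hB _ _ _ _ pa pb m n k (g v).
  (* Injectivity of [f] lets it pass through the sums without a separate finiteness argument. *)
  transitivity (f (\sum_(j \in [set: nat]) binz C m j *:
      Y (Yn a (n + j%:Z) b) (m + k - j%:Z) (g v))).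
    rewrite raddf_fsum_inj //; last exact: can_inj fK.
    by apply: eq_fsbigr => j _; rewrite linear_scale.
  rewrite e raddf_fsum_inj //; last exact: can_inj fK.
  apply: eq_fsbigr => j _; rewrite linear_scale // /transport !fK.
  by rewrite addrC -scaleNr fP scaleNr addrC.
Qed.

Lemma transport_irreducible Y :
  is_irreducible Y -> is_irreducible (transport Y).
Proof.
move=> [[v0 nz0] irr]; split.
  exists (f v0) => e; apply: nz0; apply: (can_inj fK).
  by rewrite e linear_0.
move=> U [U0 UP] stU [u Uu nzu] v.
rewrite -[v]gK; apply: (irr (fun w => U (f w))).
- by split; [rewrite linear_0 | move=> c x y Ux Uy; rewrite fP; apply: UP].
- by move=> a n w /(stU a n); rewrite /transport fK.
- exists (g u); rewrite ?gK // => e; apply: nzu; apply: (can_inj gK).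
  by rewrite e linear_0.
Qed.

End Transport.

(* V is spanned by monomials a1_(n1) ... ak_(nk) vac with the ai in S. *)
Definition strongly_generated (C : fieldType) (V : vertexSuperalgebra C)
    (S : V -> Prop) :=
  forall U : V -> Prop, is_subspace U -> U vac ->
    (forall a n v, S a -> U v -> U (Yn a n v)) -> forall v, U v.

(** * From generation as a vertex algebra to spanning by monomials *)

Section Generation.
Variables (C : fieldType) (V : vertexSuperalgebra C) (S : V -> Prop).
Hypothesis S_odd : forall a, S a -> par true a.

(** By [module_nprod], the modes of a product are combinations of composites of modes of its
    factors. Hence the vectors whose modes preserve [U] form a vertex subalgebra; it contains [S],
    so it is everything, and v = v_(-1) vac lies in [U]. *)
Lemma generated_strongly : generated_by S -> strongly_generated S.
Proof.
move=> gen U subU Uvac stU.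
(* The product formula is stated for homogeneous vectors, so the parity components are tracked
   separately. *)
pose T a := exists a0 a1, [/\ par false a0, par true a1, a = a0 + a1,
  forall n u, U u -> U (Yn a0 n u) & forall n u, U u -> U (Yn a1 n u)].
suff hT : forall a, T a.
  move=> v; have [v0 [v1 [_ _ -> h0 h1]]] := hT v.
  have -> : v0 + v1 = Yn (v0 + v1) (-1) vac by rewrite Yn_creation.
  rewrite (module_addl (adjoint_module V)).
  by apply: subspaceD; [| apply: h0 | apply: h1].
have stab p q a b : par p a -> par q b ->
    (forall n u, U u -> U (Yn a n u)) -> (forall n u, U u -> U (Yn b n u)) ->
    forall k n u, U u -> U (Yn (Yn a k b) n u).
  move=> pa pb ha hb k n u Uu; rewrite (module_nprod (adjoint_module V) _ _ _ pa pb).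
  apply: subspace_fsum => // j; apply: subspaceZ => //; apply: subspaceB => //.
    by apply/ha/hb.
  by apply: subspaceZ => //; apply/hb/ha.
have stD a b (ha : forall n u, U u -> U (Yn a n u))
    (hb : forall n u, U u -> U (Yn b n u)) n u : U u -> U (Yn (a + b) n u).
  by move=> Uu; rewrite (module_addl (adjoint_module V)); apply: subspaceD; auto.
have parD p (a b : V) : par p a -> par p b -> par p (a + b).
  by move=> ha hb; apply: (subspaceD (par_subspace V p)).
have parY p q (a b : V) n : par p a -> par q b -> par (p (+) q) (Yn a n b).
  by move=> pa; have [_ h _] := Yn_field pa; apply: h.
apply: gen; first split.
- have [U0 UP] := subU; split.
    exists 0, 0; split; rewrite ?addr0 //; try exact: par0;
      by move=> *; rewrite Yn0l.
  move=> c u v [u0 [u1 [pu0 pu1 -> hu0 hu1]]] [v0 [v1 [pv0 pv1 -> hv0 hv1]]].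
  exists (c *: u0 + v0), (c *: u1 + v1); split; try exact: par_lin.
  + by rewrite scalerDr addrACA.
  + by move=> n w Uw; rewrite Yn_linl; apply: UP; auto.
  + by move=> n w Uw; rewrite Yn_linl; apply: UP; auto.
- exists vac, 0; split; rewrite ?addr0 //; [exact: vac_even | exact: par0 | |].
    by move=> n u Uu; rewrite Yn_vac /id_field; case: ifP => _ //; case: subU.
  by move=> n u Uu; rewrite Yn0l; case: subU.
- move=> a b n [a0 [a1 [pa0 pa1 -> ha0 ha1]]] [b0 [b1 [pb0 pb1 -> hb0 hb1]]].
  exists (Yn a0 n b0 + Yn a1 n b1), (Yn a0 n b1 + Yn a1 n b0); split.
  + by apply: parD; [apply: (parY false false) | apply: (parY true true)].
  + by apply: parD; [apply: (parY false true) | apply: (parY true false)].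
  + rewrite (module_addl (adjoint_module V)) !(module_addr (adjoint_module V)).
    by rewrite [X in _ + X = _]addrC addrACA.
  + by apply: stD; apply: stab; eauto.
  + by apply: stD; apply: stab; eauto.
- move=> a Sa; exists 0, a; split; rewrite ?add0r //; [exact: par0 | exact: S_odd | |].
    by move=> n u Uu; rewrite Yn0l; case: subU.
  by move=> n u Uu; apply: stU.
Qed.
End Generation.

(** * Uniqueness of modules and irreducibility of the adjoint module *)

Section ModuleUniqueness.
Variables (C : fieldType) (V : vertexSuperalgebra C) (S : V -> Prop).
Hypothesis S_odd : forall a, S a -> par true a.
Hypothesis S_gen : strongly_generated S.

(** [P] carries the parity because the product formula is applied to homogeneous vectors; the two
    zero cases supply the missing components of [vac] and [0]. *)
Lemma strongly_generated_ind (P : bool -> V -> Prop) :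
    P false vac -> P false 0 -> P true 0 ->
    (forall p c a b, P p a -> P p b -> P p (c *: a + b)) ->
    (forall p a n b, S a -> par p b -> P p b -> P (~~ p) (Yn a n b)) ->
  forall p b, par p b -> P p b.
Proof.
move=> Pvac P0 P1 Plin PY.
pose U b := exists b0 b1,
  [/\ par false b0, par true b1, b = b0 + b1, P false b0 & P true b1].
have hU : forall b, U b.
  apply: S_gen => [||a n v Sa [v0 [v1 [p0 p1 -> h0 h1]]]].
  - split; first by exists 0, 0; split; rewrite ?addr0 //; exact: par0.
    move=> c _ _ [a0 [a1 [pa0 pa1 -> ha0 ha1]]] [b0 [b1 [pb0 pb1 -> hb0 hb1]]].
    exists (c *: a0 + b0), (c *: a1 + b1); split; try exact: par_lin.
    + by rewrite scalerDr addrACA.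
    + exact: Plin.
    + exact: Plin.
  - by exists vac, 0; split; rewrite ?addr0 //; [exact: vac_even | exact: par0].
  - have [_ hp _] := Yn_field (S_odd Sa).
    exists (Yn a n v1), (Yn a n v0); split.
    + exact: (hp true).
    + exact: (hp false).
    + by rewrite (module_addr (adjoint_module V)) addrC.
    + exact: (PY true).
    + exact: (PY false).
move=> p b pb; have [b0 [b1 [p0 p1 e h0 h1]]] := hU b.
have parB q (x y : V) : par q x -> par q y -> par q (x - y).
  by move=> hx hy; apply: (subspaceB (par_subspace V q)).
(* The component of the wrong parity is both even and odd, hence zero. *)
case: p pb => pb.
  suff b00 : b0 = 0 by rewrite e b00 add0r.
  by apply: par_disjoint => //; rewrite -[b0](addrK b1) -e; apply: parB.
suff b10 : b1 = 0 by rewrite e b10 addr0.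
apply: par_disjoint => //.
by rewrite -[b1](addKr b0) -e addrC; apply: parB.
Qed.

(** The product formula expresses [Y (Yn a n b)] through [Y a] and [Y b], so agreement on [S]
    spreads to all monomials. *)
Lemma module_unique (M : superSpace C) (Y Y' : V -> modes M) :
  is_module Y -> is_module Y' -> (forall a, S a -> Y' a = Y a) -> Y' = Y.
Proof.
move=> hY hY' hS; have [_ _ hv _] := hY; have [_ _ hv' _] := hY'.
have hom : forall p b, par p b -> Y' b = Y b.
  apply: (@strongly_generated_ind (fun _ b => Y' b = Y b)).
  - by apply/funext => n; apply/funext => v; rewrite hv hv'.
  - by apply/funext => n; apply/funext => v; rewrite !module_0l.
  - by apply/funext => n; apply/funext => v; rewrite !module_0l.
  - move=> p c a b ea eb; apply/funext => n; apply/funext => v.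
    by rewrite !module_linl // ea eb.
  - move=> p a n b Sa pb eb; apply/funext => k; apply/funext => v.
    rewrite (module_nprod hY _ _ _ (S_odd Sa) pb).
    by rewrite (module_nprod hY' _ _ _ (S_odd Sa) pb) hS // eb.
apply/funext => b; have [b0 [b1 [p0 p1 ->]]] := par_decomp b.
apply/funext => n; apply/funext => v.
by rewrite !module_addl // (hom _ _ p0) (hom _ _ p1).
Qed.

Lemma adjoint_irreducible :
    vac <> 0 :> V ->
    (forall U : V -> Prop, is_subspace U ->
       (forall a n v, S a -> U v -> U (Yn a n v)) ->
       (exists2 u, U u & u <> 0) -> U vac) ->
  is_irreducible (@Yn C V).
Proof.
move=> nz simpleV; split; first by exists vac.
by move=> U hU stU exU; apply: S_gen => //; [apply: simpleV => // | ]; auto.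
Qed.

End ModuleUniqueness.

Section Derivation.
Variables (C : fieldType) (V : vertexSuperalgebra C) (M : superSpace C).
Variable Y : V -> modes M.
Hypothesis hY : is_module Y.

(* Borcherds' identity for [a], [vac] with n = -2 and k = 0, whose right-hand
   side vanishes. *)
Lemma module_der p (a : V) n v : par p a -> Y (Dop a) n v = derz (Y a) n v.
Proof.
move=> pa; have [_ _ hv hB] := hY.
have := hB _ _ _ _ pa (vac_even V) n (-2) 0 v.
(* Since a_(j-2) vac = 0 for j > 1, two terms remain on the left: [Dop a] with coefficient 1 and [a]
   with coefficient n. *)
rewrite (@fsum_trunc _ _ 2); last first.
  move=> j hj; rewrite Yn_creation; last by lia.
  by case: ifP => [/eqP|_]; [lia | rewrite module_0l // scaler0].
rewrite big_ord_recl big_ord1 /= binz_0 binz_1 scale1r !addr0.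
rewrite [Yn a (_ + _) vac]Yn_creation //= /bump /=.
rewrite fsum0 => [|j].
  rewrite !hv /id_field /= module_0r // scaler0 subr0 scaler0 => /eqP.
  rewrite addr_eq0 => /eqP; rewrite /Dop /derz => ->.
  by rewrite mulrNz scaleNr.
rewrite !hv /id_field; have -> : (0 + j.+1%:Z == -1) = false by lia.
have -> : (-2 + 0 - j.+1%:Z == -1) = false by lia.
by rewrite module_0r // scaler0 subr0 scaler0.
Qed.

End Derivation.

(** * The Clifford module F *)

Section Fermions.
Variables (C : numClosedFieldType) (F : cliffordVSA C).
Implicit Types (v w : F) (n : int).
Local Notation psip := (Yn (Psi_plus F)).
Local Notation psim := (Yn (Psi_minus F)).
Let YF := adjoint_module F.
Let s : C := (sqrtC 2)^-1.

Lemma sqrt2V_sqr : s * s = 2^-1.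
Proof. by rewrite -invfM -expr2 sqrtCK. Qed.

Lemma psip_odd : par true (Psi_plus F).
Proof.
rewrite Psi_plusE; apply: par_lin; first exact: Phi_odd.
by rewrite -[_ *: _]addr0; apply: par_lin; [exact: Phi_odd | exact: par0].
Qed.

(** The contraction vanishes because 1 + i^2 = 0: [Psi_plus] is isotropic. *)
Lemma psip_psip m n v : psip m (psip n v) = - psip n (psip m v).
Proof.
apply/eqP; rewrite -addr_eq0 Psi_plusE lin12_anticomm; case: ifP => // _.
by rewrite mulrACA -!expr2 sqrCi mulrN1 subrr scale0r.
Qed.

Lemma psim_psim m n v : psim m (psim n v) = - psim n (psim m v).
Proof.
apply/eqP; rewrite -addr_eq0 Psi_minusE lin12_anticomm; case: ifP => // _.
by rewrite mulrNN mulrACA -!expr2 sqrCi mulrN1 subrr scale0r.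
Qed.

Lemma psip_psim m n v :
  psip m (psim n v) = (if m + n + 1 == 0 then v else 0) - psim n (psip m v).
Proof.
apply/eqP; rewrite eq_sym subr_eq eq_sym Psi_plusE Psi_minusE lin12_anticomm.
case: ifP => // _; rewrite mulrN mulrACA -expr2 -expr2 sqrCi mulrN1 opprK.
by rewrite expr2 sqrt2V_sqr -mulr2n -[_ *+ 2]mulr_natr mulVf ?scale1r ?pnatr_eq0.
Qed.

Lemma psim_psip m n v :
  psim m (psip n v) = (if m + n + 1 == 0 then v else 0) - psip n (psim m v).
Proof. by rewrite psip_psim [n + m]addrC opprB addrCA subrr addr0. Qed.

Lemma psip_psim_neq m n v :
  m + n + 1 != 0 -> psip m (psim n v) = - psim n (psip m v).
Proof. by rewrite psip_psim => /negbTE ->; rewrite add0r. Qed.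

Lemma psim_psip_neq m n v :
  m + n + 1 != 0 -> psim m (psip n v) = - psip n (psim m v).
Proof. by rewrite psim_psip => /negbTE ->; rewrite add0r. Qed.

Lemma self_opp_eq0 v : v = - v -> v = 0.
Proof.
move/eqP; rewrite -addr_eq0 -mulr2n -scaler_nat scaler_eq0 pnatr_eq0 /=.
by move/eqP.
Qed.

Lemma psip_sqr n v : psip n (psip n v) = 0.
Proof. exact/self_opp_eq0/psip_psip. Qed.

Lemma psim_sqr n v : psim n (psim n v) = 0.
Proof. exact/self_opp_eq0/psim_psim. Qed.

Lemma psi_vac (a : F) n : 0 <= n -> Yn a n vac = 0.
Proof. by move=> hn; rewrite Yn_creation; [case: ifP => //|]; lia. Qed.

Lemma psip_mode n v : psip n v = s *: (Yn (Phi1 F) n v + 'i *: Yn (Phi2 F) n v).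
Proof. by rewrite Psi_plusE lin12_mode scalerDr scalerA. Qed.

Lemma psim_mode n v : psim n v = s *: (Yn (Phi1 F) n v - 'i *: Yn (Phi2 F) n v).
Proof. by rewrite Psi_minusE lin12_mode scalerBr scalerA scaleNr. Qed.

Lemma Phi1_mode n v : Yn (Phi1 F) n v = s *: (psip n v + psim n v).
Proof.
rewrite psip_mode psim_mode -scalerDr addrACA subrr addr0 -mulr2n -scaler_nat.
by rewrite !scalerA mulrA sqrt2V_sqr mulVf ?scale1r ?pnatr_eq0.
Qed.

Lemma Phi2_mode n v : Yn (Phi2 F) n v = - ('i * s) *: (psip n v - psim n v).
Proof.
rewrite psip_mode psim_mode -scalerBr opprB addrC addrA subrK -mulr2n -scaler_nat.
rewrite !scalerA; have -> : - ('i * s) * (s * 2) * 'i = - ('i ^+ 2) * (s * s) * 2.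
  by ring.
by rewrite sqrCi opprK mul1r sqrt2V_sqr mulVf ?pnatr_eq0 ?scale1r.
Qed.

(** The modes of [Phi1] and [Phi2] are combinations of [psip] and [psim] of the same index, so
    generation by [Phi] becomes an induction principle in the isotropic basis. *)
Lemma psi_cyclic (U : F -> Prop) : is_subspace U -> U vac ->
    (forall n v, U v -> U (psip n v)) -> (forall n v, U v -> U (psim n v)) ->
  forall v, U v.
Proof.
move=> hU Uvac Up Um; apply: (generated_strongly _ (Phi_gen (c := F))) => //.
  by move=> _ [i ->]; apply: Phi_odd.
move=> _ n v [i ->] Uv.
have [->|->] : i = 0 \/ i = 1.
- by case: i => [[|[|k]]] hi //; [left|right]; apply: val_inj.
- rewrite -/(Phi1 F) Phi1_mode; apply: subspaceZ => //; apply: subspaceD; auto.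
- rewrite -/(Phi2 F) Phi2_mode; apply: subspaceZ => //; apply: subspaceB; auto.
Qed.

(* Anticommutation moves annihilators to the right, so that F is spanned by
   creators applied to the vacuum. *)
Lemma creation_span (U : F -> Prop) : is_subspace U -> U vac ->
    (forall n v, n < 0 -> U v -> U (psip n v)) ->
    (forall n v, n < 0 -> U v -> U (psim n v)) ->
  forall v, U v.
Proof.
pose closed (X : F -> Prop) := [/\ is_subspace X, X vac,
  forall n v, n < 0 -> X v -> X (psip n v) &
  forall n v, n < 0 -> X v -> X (psim n v)].
pose T v := forall X, closed X -> X v.
have T_sub : is_subspace T.
  split=> [|c u v hu hv] X hX; have [[X0 XP] _ _ _] := hX => //.
  by apply: XP; [apply: hu | apply: hv].
have Tvac : T vac by move=> X [].
have Tp n v : n < 0 -> T v -> T (psip n v).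
  by move=> hn hv X hX; have [_ _ h _] := hX; apply: h => //; apply: hv.
have Tm n v : n < 0 -> T v -> T (psim n v).
  by move=> hn hv X hX; have [_ _ _ h] := hX; apply: h => //; apply: hv.
move=> hU Uvac Up Um; suff hT : forall v, T v by move=> v; apply: hT.
(* [A] collects the vectors of [T] whose images under every annihilator stay in [T]. It is closed
   under creators, so it contains [T]; thus [T] is stable under all modes and [psi_cyclic]
   applies. *)
pose A v := T v /\ forall n, 0 <= n -> T (psip n v) /\ T (psim n v).
have hif b v : T v -> T (if b then v else 0).
  by move=> hv; case: b => //; case: T_sub.
have hA : closed A.
  split.
  - split.
      split; first by case: T_sub.
      by move=> n hn; rewrite !Yn0r; split; case: T_sub.
    move=> c u v [Tu hu] [Tv hv]; split; first by case: T_sub => _; apply.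
    move=> n hn; have [up um] := hu n hn; have [vp vm] := hv n hn.
    by rewrite !Yn_linr; split; case: T_sub => _; apply.
  - split => // n hn; rewrite !psi_vac //.
    by case: T_sub.
  - move=> n v hn [Tv hv]; split; first exact: Tp.
    move=> k hk; have [vp vm] := hv k hk; rewrite psip_psip psim_psip; split.
      by apply: (subspaceN T_sub); apply: Tp.
    by apply: (subspaceB T_sub); [apply: hif | apply: Tp].
  - move=> n v hn [Tv hv]; split; first exact: Tm.
    move=> k hk; have [vp vm] := hv k hk; rewrite psim_psim psip_psim; split.
      by apply: (subspaceB T_sub); [apply: hif | apply: Tm].
    by apply: (subspaceN T_sub); apply: Tm.
apply: psi_cyclic => // n v Tv.
  case: (ltrP n 0) => hn; first exact: Tp.
  by have [_ h] := Tv _ hA; case: (h n hn).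
case: (ltrP n 0) => hn; first exact: Tm.
by have [_ h] := Tv _ hA; case: (h n hn).
Qed.

(* The projection killing every monomial that contains a creator of index k,
   along the kernel of the two annihilators of index k. *)
Definition mode_proj (k : nat) v :=
  psip k (psim (- k%:Z - 1) (psim k (psip (- k%:Z - 1) v))).

(** The creators conjugate to the annihilators of index k are the modes -k-1; this composite removes
    those with k < N. *)
Fixpoint vac_proj (N : nat) v :=
  if N is k.+1 then vac_proj k (mode_proj k v) else v.

Lemma mode_proj_lin k (c : C) v w :
  mode_proj k (c *: v + w) = c *: mode_proj k v + mode_proj k w.
Proof. by rewrite /mode_proj !Yn_linr. Qed.

Lemma vac_proj_lin N (c : C) v w :
  vac_proj N (c *: v + w) = c *: vac_proj N v + vac_proj N w.
Proof. by elim: N v w => //= k IH v w; rewrite mode_proj_lin IH. Qed.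

Lemma mode_proj_annihilated (k : nat) v :
  psip k v = 0 -> psim k v = 0 -> mode_proj k v = v.
Proof.
move=> hp hm; rewrite /mode_proj psim_psip hm Yn0r subr0.
have -> : (k%:Z + (- k%:Z - 1) + 1 == 0) = true by lia.
rewrite psip_psim hp Yn0r subr0.
by have -> : (k%:Z + (- k%:Z - 1) + 1 == 0) = true by lia.
Qed.

Lemma vac_proj_annihilated N v :
  (forall n, 0 <= n -> psip n v = 0 /\ psim n v = 0) -> vac_proj N v = v.
Proof.
move=> h; elim: N => //= k IH.
by rewrite mode_proj_annihilated ?IH //; case: (h k _).
Qed.

Lemma Yn_oppr (a : F) n v : Yn a n (- v) = - Yn a n v.
Proof. by rewrite -scaleN1r (module_scaler YF) scaleN1r. Qed.

Lemma vac_proj_0 N : vac_proj N 0 = 0.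
Proof.
by have := vac_proj_lin N (-1) 0 0; rewrite scaler0 addr0 scaleN1r addNr.
Qed.

Lemma mode_proj_psip k v : mode_proj k (psip (- k%:Z - 1) v) = 0.
Proof. by rewrite /mode_proj psip_sqr !Yn0r. Qed.

Lemma mode_proj_psim k v : mode_proj k (psim (- k%:Z - 1) v) = 0.
Proof.
rewrite /mode_proj [psip (- k%:Z - 1) _]psip_psim_neq; last by lia.
by rewrite Yn_oppr psim_psim opprK psim_sqr Yn0r.
Qed.

(** Four odd operators are crossed, so the signs cancel, and distinct indices leave no
    contraction. *)
Lemma mode_proj_psipC (k l : nat) v : k <> l ->
  mode_proj k (psip (- l%:Z - 1) v) = psip (- l%:Z - 1) (mode_proj k v).
Proof.
move=> kl; rewrite /mode_proj [psip (- k%:Z - 1) _]psip_psip Yn_oppr.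
rewrite psim_psip_neq ?opprK; last by lia.
rewrite psim_psip_neq ?Yn_oppr; last by lia.
by rewrite psip_psip opprK.
Qed.

Lemma mode_proj_psimC (k l : nat) v : k <> l ->
  mode_proj k (psim (- l%:Z - 1) v) = psim (- l%:Z - 1) (mode_proj k v).
Proof.
move=> kl; rewrite /mode_proj [psip (- k%:Z - 1) _]psip_psim_neq; last by lia.
rewrite Yn_oppr [psim k (psim _ _)]psim_psim opprK psim_psim Yn_oppr.
by rewrite psip_psim_neq ?opprK; last by lia.
Qed.

Lemma vac_proj_psip N k v : (k < N)%N -> vac_proj N (psip (- k%:Z - 1) v) = 0.
Proof.
elim: N v => // N IH v; rewrite ltnS leq_eqVlt => /predU1P[<-|lt_kN] /=.
  by rewrite mode_proj_psip vac_proj_0.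
by rewrite mode_proj_psipC ?IH //; lia.
Qed.

Lemma vac_proj_psim N k v : (k < N)%N -> vac_proj N (psim (- k%:Z - 1) v) = 0.
Proof.
elim: N v => // N IH v; rewrite ltnS leq_eqVlt => /predU1P[<-|lt_kN] /=.
  by rewrite mode_proj_psim vac_proj_0.
by rewrite mode_proj_psimC ?IH //; lia.
Qed.

(** By [creation_span] it is enough to treat the vacuum, which is fixed, and vectors starting with a
    creator, which die once [N] exceeds its index. *)
Lemma vac_proj_eventually v :
  exists N0, forall N, (N0 <= N)%N -> exists c : C, vac_proj N v = c *: vac.
Proof.
move: v; apply: creation_span.
- split; first by exists 0%N => N _; exists 0; rewrite vac_proj_0 scale0r.
  move=> c v w [Nv hv] [Nw hw]; exists (maxn Nv Nw) => N.
  rewrite geq_max => /andP[/hv[a ea] /hw[b eb]]; exists (c * a + b).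
  by rewrite vac_proj_lin ea eb scalerDl scalerA.
- exists 0%N => N _; exists 1; rewrite scale1r vac_proj_annihilated // => n hn.
  by rewrite !psi_vac.
- case=> // k v _ _; exists k.+1 => N hN; exists 0.
  have -> : Negz k = - k%:Z - 1 by lia.
  by rewrite vac_proj_psip // scale0r.
- case=> // k v _ _; exists k.+1 => N hN; exists 0.
  have -> : Negz k = - k%:Z - 1 by lia.
  by rewrite vac_proj_psim // scale0r.
Qed.

(** The projections fix such a vector, yet eventually send it to the vacuum line. *)
Lemma annihilated_vac v :
  (forall n, 0 <= n -> psip n v = 0 /\ psim n v = 0) ->
  exists c : C, v = c *: vac.
Proof.
move=> h; have [N /(_ N (leqnn N)) [c e]] := vac_proj_eventually v.
by exists c; rewrite -e vac_proj_annihilated.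
Qed.

(** All annihilators of large index kill a given vector. The bound is lowered one index at a time:
    an annihilator that does not kill the vector is applied to it, and kills the result because it
    squares to zero. *)
Lemma annihilators_reach_vac (U : F -> Prop) : is_subspace U ->
    (forall n v, 0 <= n -> U v -> U (psip n v)) ->
    (forall n v, 0 <= n -> U v -> U (psim n v)) ->
  (exists2 v, U v & v <> 0) -> U vac.
Proof.
move=> hU Up Um [v Uv nzv].
suff reach (k : nat) (w : F) : U w -> w <> 0 ->
    (forall n, k%:Z <= n -> psip n w = 0 /\ psim n w = 0) -> U vac.
  have [_ _ hp] := Yn_field psip_odd; have [_ _ hm] := Yn_field (Psi_minus_odd F).
  have [Np {}hp] := hp v; have [Nm {}hm] := hm v.
  apply: (reach (`|Np| + `|Nm|)%N v) => // n hn.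
  by split; [apply: hp | apply: hm]; lia.
elim: k w => [|k IH] w Uw nzw hw.
  have [c e] := annihilated_vac hw.
  have c0 : c != 0 by apply/eqP => c0; apply: nzw; rewrite e c0 scale0r.
  by rewrite -[vac](scalerK c0) -e; apply: subspaceZ.
have [w1 [Uw1 nz1 hw1 k1]] : exists w1, [/\ U w1, w1 <> 0,
    forall n, k.+1%:Z <= n -> psip n w1 = 0 /\ psim n w1 = 0 & psip k w1 = 0].
  have [e|ne] := eqVneq (psip k w) 0; first by exists w.
  exists (psip k w); split; [exact: Up | exact/eqP | | exact: psip_sqr].
  move=> n hn; have [e1 e2] := hw n hn.
  by rewrite psip_psip psim_psip_neq ?e1 ?e2 ?Yn0r ?oppr0 //; lia.
(* Applying [psim k] preserves what was gained with [psip k]: two annihilators have no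
   contraction. *)
have [w2 [Uw2 nz2 hw2]] : exists w2, [/\ U w2, w2 <> 0 &
    forall n, k%:Z <= n -> psip n w2 = 0 /\ psim n w2 = 0].
  have split_n n : k%:Z <= n -> n = k \/ k.+1%:Z <= n by lia.
  have [e|ne] := eqVneq (psim k w1) 0.
    by exists w1; split => // n /split_n[->|/hw1].
  exists (psim k w1); split; [exact: Um | exact/eqP |].
  move=> n /split_n[->|hn].
    by rewrite psim_sqr psip_psim_neq ?k1 ?Yn0r ?oppr0 //; lia.
  have [e1 e2] := hw1 n hn.
  by rewrite psim_psim psip_psim_neq ?e1 ?e2 ?Yn0r ?oppr0 //; lia.
exact: (IH w2).
Qed.

(* [psim 0 \o psip (-1)] projects F onto the kernel of [psim 0], along the image
   of [psip (-1)]. *)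
Lemma ker_psim0_span (U : F -> Prop) : is_subspace U -> U vac ->
    (forall n v, n != -1 -> U v -> U (psip n v)) ->
    (forall n v, U v -> U (psim n v)) ->
  forall v, psim 0 v = 0 -> U v.
Proof.
move=> hU Uvac Up Um v hv.
(* The two claims feed each other: mode -1 of [psip] reduces the second to the first, and mode 0 of
   [psim] reduces the first to the second. *)
suff hT : forall w, U (psim 0 (psip (-1) w)) /\ U (psim 0 w).
  by have [] := hT v; rewrite psim_psip hv Yn0r subr0.
apply: psi_cyclic.
- have [U0 UP] := hU; split; first by rewrite !Yn0r.
  by move=> c x y [hx1 hx2] [hy1 hy2]; rewrite !Yn_linr; split; apply: UP.
- rewrite psim_psip psi_vac // Yn0r subr0; split => //.
  by case: hU.
- move=> n w [h1 h2]; have [->|hn] := eqVneq n (-1).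
    by rewrite psip_sqr Yn0r; split => //; case: hU.
  split.
    rewrite psip_psip Yn_oppr psim_psip_neq ?opprK; last by lia.
    exact: Up.
  rewrite psim_psip_neq; last by lia.
  by apply: subspaceN => //; apply: Up.
- move=> n w [h1 h2]; split; last first.
    by rewrite psim_psim; apply: subspaceN => //; apply: Um.
  have [->|hn] := eqVneq n 0.
    by rewrite psim_psip psim_sqr Yn0r subr0.
  rewrite psip_psim_neq; last by lia.
  by rewrite Yn_oppr psim_psim opprK; apply: Um.
Qed.
End Fermions.

(** * The exponential of u_(1) *)

Section Exponential.
Variables (C : numFieldType) (V : lmodType C) (S : V -> V).
Hypothesis S_lin : forall (c : C) u v, S (c *: u + v) = c *: S u + S v.
Hypothesis S_nil : forall v, exists N, iter N S v == 0.

Lemma iter_lin k (c : C) u v :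
  iter k S (c *: u + v) = c *: iter k S u + iter k S v.
Proof. by elim: k => //= k ->; rewrite S_lin. Qed.

Lemma iter_ge_eq0 N k v : iter N S v = 0 -> (N <= k)%N -> iter k S v = 0.
Proof.
move=> e /subnK <-; rewrite iterD e; elim: (k - N)%N => //= n ->.
exact: (linear_0 S_lin).
Qed.

Definition exp_op (t : C) v :=
  \sum_(k < ex_minn (S_nil v)) (t ^+ k / k`!%:R) *: iter k S v.

(** Any truncation bound gives the same value, so several vectors can share one. *)
Lemma exp_opE t N v : iter N S v = 0 ->
  exp_op t v = \sum_(k < N) (t ^+ k / k`!%:R) *: iter k S v.
Proof.
move=> e; rewrite /exp_op; case: ex_minnP => m /eqP e0 min_m.
have le_mN : (m <= N)%N by apply: min_m; rewrite e.
rewrite -(subnKC le_mN) big_split_ord /= [X in _ = _ + X]big1 ?addr0 // => i _.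
by rewrite (iter_ge_eq0 e0) ?scaler0 // leq_addr.
Qed.

Lemma exp_op_lin t (c : C) u v :
  exp_op t (c *: u + v) = c *: exp_op t u + exp_op t v.
Proof.
have [M /eqP eM] := S_nil u; have [N /eqP eN] := S_nil v.
have uK := iter_ge_eq0 eM (leq_maxl M N); have vK := iter_ge_eq0 eN (leq_maxr M N).
rewrite (exp_opE t uK) (exp_opE t vK) (@exp_opE t (maxn M N)); last first.
  by rewrite iter_lin uK vK scaler0 addr0.
rewrite scaler_sumr -big_split; apply: eq_bigr => k _ /=.
by rewrite iter_lin scalerDr !scalerA mulrC.
Qed.

Lemma exp_op_fix t v : S v = 0 -> exp_op t v = v.
Proof.
by move=> e; rewrite (@exp_opE t 1) // big_ord1 /= expr0 divr1 scale1r.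
Qed.

Section Commutation.
Variables B D : V -> V.
Hypothesis B_lin : forall (c : C) u v, B (c *: u + v) = c *: B u + B v.
Hypothesis D_lin : forall (c : C) u v, D (c *: u + v) = c *: D u + D v.
Hypothesis SB : forall v, S (B v) = B (S v) + D v.
Hypothesis SD : forall v, S (D v) = D (S v).

(** As [D] commutes with [S], each of the k factors contributes one copy of [D]. At k = 0 the
    default [k.-1 = 0] has coefficient zero. *)
Lemma iter_commutation k v :
  iter k S (B v) = B (iter k S v) + k%:R *: D (iter k.-1 S v).
Proof.
elim: k => [|k IH] /=; first by rewrite scale0r addr0.
rewrite IH addrC S_lin SD SB addrC -addrA -[k.+1%:R]natr1 scalerDl scale1r.
congr (_ + _); rewrite addrC; congr (_ + _).
by case: k {IH} => [|k] //; rewrite !scale0r.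
Qed.

(** [S, B] = D commutes with S, so conjugation by exp(tS) stops at first order and sends B to B +
    tD. *)
Lemma exp_op_commutation t v :
  exp_op t (B v) = B (exp_op t v) + t *: D (exp_op t v).
Proof.
have [N /eqP eN] := S_nil v.
(* The bound is [N.+1] because S^k B v involves S^(k-1) v. *)
have eN1 := iter_ge_eq0 eN (leqnSn N).
rewrite (@exp_opE t N.+1 (B v)); last first.
  by rewrite iter_commutation eN1 /= eN (linear_0 B_lin) (linear_0 D_lin) scaler0 addr0.
under eq_bigr => k _ do rewrite iter_commutation scalerDr.
rewrite big_split /=; congr (_ + _).
  rewrite (exp_opE t eN1) (linear_sum B_lin); apply: eq_bigr => k _.
  by rewrite (linear_scale B_lin).
(* The term k = 0 vanishes; after the shift, t^(k+1) (k+1) / (k+1)! = t (t^k / k!). *)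
rewrite big_ord_recl /= scale0r scaler0 add0r (exp_opE t eN).
rewrite (linear_sum D_lin) scaler_sumr; apply: eq_bigr => k _.
rewrite (linear_scale D_lin) !scalerA /bump /= add1n exprS factS natrM; congr (_ *: _).
by field; rewrite nat1r !pnatr_eq0 -lt0n fact_gt0.
Qed.

End Commutation.
End Exponential.

(** * The automorphism exp(t u_(1)) of the superspace F *)

Section Twist.
Variables (C : numClosedFieldType) (F : cliffordVSA C).
Implicit Types (v w : F) (n : int).
Local Notation psip := (Yn (Psi_plus F)).
Local Notation psim := (Yn (Psi_minus F)).
Let YF := adjoint_module F.

Definition psip_quad : F := psip (-2) (Psi_plus F).
Local Notation u := psip_quad.

Lemma psip_quad_even : par false u.
Proof. by have [_ h _] := Yn_field (psip_odd F); apply: (h true); apply: psip_odd. Qed.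

Lemma psip_Psi_plus j : 0 <= j -> psip j (Psi_plus F) = 0.
Proof. by move=> hj; rewrite [X in psip j X]modeE psip_psip psi_vac // Yn0r oppr0. Qed.

Lemma psip_Psi_minus j : 0 <= j ->
  psip j (Psi_minus F) = if j == 0 then vac else 0.
Proof.
move=> hj; rewrite [X in psip j X]modeE psip_psim psi_vac // Yn0r subr0.
by rewrite subrK.
Qed.

Lemma psip_quad_mode k v : Yn u k v = \sum_(j \in [set: nat])
  ((-1) ^+ j * binz C (-2) j) *:
    (psip (-2 - j%:Z) (psip (k + j%:Z) v) + psip (-2 + k - j%:Z) (psip j%:Z v)).
Proof.
rewrite (module_nprod YF _ _ _ (psip_odd F) (psip_odd F)).
apply: eq_fsbigr => j _; congr (_ *: (_ + _)).
have e : (-1) ^ (-2) = 1 :> C by rewrite /exprz /= sqrrN expr1n invr1.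
by rewrite /psign /= expr1 e mul1r scaleN1r opprK.
Qed.

Lemma psip_quad_Psi_plus j : 0 <= j -> Yn u j (Psi_plus F) = 0.
Proof.
move=> hj; rewrite psip_quad_mode fsbig1 // => i _.
by rewrite !psip_Psi_plus ?Yn0r ?addr0 ?scaler0 //; lia.
Qed.

(** The only nonzero values are u_(0) Psi^- = 2 D Psi^+ and u_(1) Psi^- = Psi^+. *)
Lemma psip_quad_Psi_minus j : 0 <= j ->
  Yn u j (Psi_minus F)
  = psip (-2) (if j == 0 then vac else 0) + psip (j - 2) vac.
Proof.
move=> hj; rewrite psip_quad_mode fsum0 => [|i].
  by rewrite binz_0 !mulr1 scale1r !addr0 !psip_Psi_minus //= addrC [_ + j]addrC addrC.
rewrite !psip_Psi_minus; try lia.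
rewrite (_ : (j + i.+1%:Z == 0) = false); last by lia.
by rewrite /= !Yn0r addr0 scaler0.
Qed.

Lemma psip_quad0_mode q (b : F) k v : par q b ->
  Yn u 0 (Yn b k v) = Yn b k (Yn u 0 v) + Yn (Yn u 0 b) k v.
Proof.
move=> pb; have := module_commutator YF 0 k v psip_quad_even pb.
rewrite (@fsum_trunc _ _ 1) => [|j hj]; last by rewrite binz_nat_small ?scale0r.
rewrite big_ord1 binz_0 !scale1r add0r subr0 => <-.
by rewrite addrC subrK.
Qed.

Lemma psip_quad1_mode q (b : F) k v : par q b ->
  Yn u 1 (Yn b k v)
  = Yn b k (Yn u 1 v) + (Yn (Yn u 0 b) (k + 1) v + Yn (Yn u 1 b) k v).
Proof.
move=> pb; have := module_commutator YF 1 k v psip_quad_even pb.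
rewrite (@fsum_trunc _ _ 2) => [|j hj]; last by rewrite binz_nat_small ?scale0r.
rewrite big_ord_recl big_ord1 binz_0 binz_1 !scale1r /= subr0 /bump /=.
rewrite [1 + k]addrC addrK => <-.
by rewrite addrC subrK.
Qed.

Lemma psip_quad0_psip k v : Yn u 0 (psip k v) = psip k (Yn u 0 v).
Proof.
by rewrite (psip_quad0_mode _ _ (psip_odd F)) psip_quad_Psi_plus // Yn0l addr0.
Qed.

Lemma psip_quad1_psip k v : Yn u 1 (psip k v) = psip k (Yn u 1 v).
Proof.
by rewrite (psip_quad1_mode _ _ (psip_odd F)) !psip_quad_Psi_plus // !Yn0l !addr0.
Qed.

Lemma DPsi_plus_mode n v : Yn (Dop (Psi_plus F)) n v = - n%:~R *: psip (n - 1) v.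
Proof. by rewrite (module_der YF _ _ (psip_odd F)) /derz mulrNz. Qed.

Lemma psip_quad1_psim k v :
  Yn u 1 (psim k v) = psim k (Yn u 1 v) + - (k * 2 + 1)%:~R *: psip k v.
Proof.
rewrite (psip_quad1_mode _ _ (Psi_minus_odd F)) !psip_quad_Psi_minus //=.
rewrite Yn0r !add0r -[psip (1 - 2) vac]modeE.
(* The u_(0) part contributes -2(k+1) and the u_(1) part +1, in total -(2k+1). *)
rewrite (module_addl YF) DPsi_plus_mode addrK -[X in _ + (_ + X)]scale1r.
rewrite -scalerDl -scalerDl; congr (_ + _ *: _).
by rewrite !rmorphD rmorphM /=; ring.
Qed.

(** The vacuum is killed, [psip] keeps a nilpotency bound, and [psim] raises it by at most one. *)
Lemma psip_quad1_nil v : exists N, iter N (Yn u 1) v == 0.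
Proof.
have linS := module_linr YF u 1.
apply: (@psi_cyclic _ _ (fun v => exists N, iter N (Yn u 1) v == 0)).
- split; first by exists 0%N.
  move=> c x y [M /eqP eM] [N /eqP eN]; exists (maxn M N).
  rewrite iter_lin // (iter_ge_eq0 linS eM) ?leq_maxl //.
  by rewrite (iter_ge_eq0 linS eN) ?leq_maxr // scaler0 addr0.
- by exists 1%N; rewrite /= psi_vac.
- move=> n w [N /eqP e]; exists N.
  rewrite (@iter_commutation _ _ _ linS _ (fun=> 0)) => [|x|x].
  + by rewrite e Yn0r scaler0 addr0.
  + by rewrite psip_quad1_psip addr0.
  + by rewrite Yn0r.
- move=> n w [N /eqP e]; exists N.+1.
  rewrite (@iter_commutation _ _ _ linS _ (fun x => - (n * 2 + 1)%:~R *: psip n x)).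
  + by rewrite /= e !Yn0r !scaler0 addr0.
  + by move=> x; rewrite psip_quad1_psim.
  + by move=> x; rewrite (module_scaler YF) psip_quad1_psip.
Qed.

Definition twist : C -> F -> F := exp_op psip_quad1_nil.

Lemma twist_lin t (c : C) v w : twist t (c *: v + w) = c *: twist t v + twist t w.
Proof. exact: (exp_op_lin (module_linr YF u 1)). Qed.

Lemma twist_vac t : twist t vac = vac.
Proof. by apply: (exp_op_fix (module_linr YF u 1)); rewrite psi_vac. Qed.

Lemma twist_psip t n v : twist t (psip n v) = psip n (twist t v).
Proof.
rewrite /twist (@exp_op_commutation _ _ _ (module_linr YF u 1) _ _ (fun=> 0)).
- by rewrite scaler0 addr0.
- exact: (module_linr YF).
- by move=> c x y; rewrite scaler0 addr0.
- by move=> x; rewrite psip_quad1_psip addr0.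
- by move=> x; rewrite Yn0r.
Qed.

Lemma twist_psim t n v : twist t (psim n v)
  = psim n (twist t v) - (t * (n * 2 + 1)%:~R) *: psip n (twist t v).
Proof.
rewrite /twist (@exp_op_commutation _ _ _ (module_linr YF u 1) _ _
  (fun x => - (n * 2 + 1)%:~R *: psip n x)).
- by rewrite scalerA mulrN scaleNr.
- exact: (module_linr YF).
- by move=> c x y; rewrite Yn_linr scalerDr !scalerA mulrC.
- by move=> x; rewrite psip_quad1_psim.
- by move=> x; rewrite (module_scaler YF) psip_quad1_psip.
Qed.

Lemma twist_par t p v : par p v -> par p (twist t v).
Proof.
move=> pv; rewrite /twist /exp_op.
have [_ h _] := Yn_field psip_quad_even.
apply: big_ind => [|x y px py|k _]; first exact: par0.
  by apply: (subspaceD (par_subspace F p)).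
apply: (subspaceZ (par_subspace F p)).
by elim: (k : nat) => //= i; apply: (h p).
Qed.

(** Checked on the vacuum and along [psip] and [psim], which avoids multiplying exponential
    series. *)
Lemma twistK t : cancel (twist t) (twist (- t)).
Proof.
apply: psi_cyclic.
- split; first by rewrite !(linear_0 (twist_lin _)).
  by move=> c x y ex ey; rewrite !twist_lin ex ey.
- by rewrite !twist_vac.
- by move=> n v e; rewrite !twist_psip e.
- move=> n v e; rewrite twist_psim -scaleNr addrC twist_lin twist_psim twist_psip e.
  by rewrite mulNr scaleNr opprK addrC addrK.
Qed.

Lemma twist_NK t : cancel (twist (- t)) (twist t).
Proof. by move=> v; rewrite -{1}[t]opprK twistK. Qed.

(* [psip_(-2) Psi_-] is the conformal vector of SF(1). *)
Lemma twist_omega_sf t n v :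
  twist t (Yn (psip (-2) (Psi_minus F)) n v)
  = Yn (psip (-2) (Psi_minus F)) n (twist t v) + t *: Yn u n (twist t v).
Proof.
have even_w : par false (psip (-2) (Psi_minus F)).
  by have [_ h _] := Yn_field (psip_odd F); apply: (h true); apply: Psi_minus_odd.
apply: (exp_op_commutation (module_linr YF u 1)).
- exact: (module_linr YF).
- exact: (module_linr YF).
(* With w = psip_(-2) Psi^-, u_(0) w = 2 psip_(-2) psip_(-2) vac = 0 and u_(1) w = psip_(-2) Psi^+ =
   u, so the commutator with w_(n) is u_(n). *)
- move=> x; rewrite (psip_quad1_mode _ _ even_w) psip_quad0_psip psip_quad1_psip.
  rewrite !psip_quad_Psi_minus //= Yn0r !add0r -[psip (1 - 2) vac]modeE.
  by rewrite (module_addr YF) psip_sqr addr0 Yn0l add0r.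
- move=> x; rewrite (psip_quad1_mode _ _ psip_quad_even).
  rewrite {1 3}/psip_quad psip_quad0_psip psip_quad1_psip !psip_quad_Psi_plus //.
  by rewrite !Yn0r !Yn0l !addr0.
Qed.

End Twist.

(** * The isomorphism between SF(1) and Fbar *)

Section Isomorphism.
Variables (C : numClosedFieldType) (F : cliffordVSA C).
Implicit Types n : int.
Local Notation psip := (Yn (Psi_plus F)).
Local Notation psim := (Yn (Psi_minus F)).
Let YF := adjoint_module F.

(** At mode 0, [twist_psim] turns [psim] into [psim - psip], a multiple of the mode of [Phi2]. *)
Lemma twist_SF v : v \in ker_pred (Psi_minus F) -> twist 1 v \in ker_pred (Phi2 F).
Proof.
rewrite !unfold_in => /eqP kv; have := twist_psim 1 0 v.
rewrite kv (linear_0 (twist_lin _)) Phi2_mode mul0r add0r mul1r scale1r => e.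
by rewrite -opprB -e oppr0 scaler0.
Qed.

Lemma twist_Fbar v : v \in ker_pred (Phi2 F) -> twist (-1) v \in ker_pred (Psi_minus F).
Proof.
rewrite !unfold_in Phi2_mode scaler_eq0 oppr_eq0 mulf_eq0 invr_eq0 sqrtC_eq0.
rewrite pnatr_eq0 orbF (negbTE (neq0Ci C)) /= subr_eq0 => /eqP e.
have := twist_psim (-1) 0 v; rewrite -e twist_psip mul0r add0r mulr1 scaleN1r opprK.
by move/eqP; rewrite -subr_eq subrr eq_sym.
Qed.

Definition SF_to_Fbar (v : SF F) : Fbar F :=
  Sub (twist 1 (val v)) (twist_SF (valP v)).
Definition Fbar_to_SF (v : Fbar F) : SF F :=
  Sub (twist (-1) (val v)) (twist_Fbar (valP v)).

Lemma SF_to_Fbar_lin (c : C) (v w : SF F) :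
  SF_to_Fbar (c *: v + w) = c *: SF_to_Fbar v + SF_to_Fbar w.
Proof. by apply: val_inj; rewrite [RHS]ker_valP !SubK -twist_lin -ker_valP. Qed.

Lemma Fbar_to_SF_lin (c : C) (v w : Fbar F) :
  Fbar_to_SF (c *: v + w) = c *: Fbar_to_SF v + Fbar_to_SF w.
Proof. by apply: val_inj; rewrite [RHS]ker_valP !SubK -twist_lin -ker_valP. Qed.

Lemma SF_to_Fbar_par p (v : SF F) : par p v -> par p (SF_to_Fbar v).
Proof. exact: twist_par. Qed.

Lemma Fbar_to_SF_par p (v : Fbar F) : par p v -> par p (Fbar_to_SF v).
Proof. exact: twist_par. Qed.

Lemma SF_to_FbarK : cancel SF_to_Fbar Fbar_to_SF.
Proof. by move=> v; apply: val_inj; rewrite /= twistK. Qed.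

Lemma Fbar_to_SFK : cancel Fbar_to_SF SF_to_Fbar.
Proof. by move=> v; apply: val_inj; rewrite /= twist_NK. Qed.

Lemma SF_to_Fbar_vac : SF_to_Fbar vac = vac.
Proof. by apply: val_inj; rewrite /= twist_vac. Qed.

Lemma Fbar_to_SF_vac : Fbar_to_SF vac = vac.
Proof. by apply: val_inj; rewrite /= twist_vac. Qed.

Definition Y_SF : SF F -> modes (Fbar F) :=
  transport SF_to_Fbar Fbar_to_SF (@Yn C (SF F)).
Definition Y_Fbar : Fbar F -> modes (SF F) :=
  transport Fbar_to_SF SF_to_Fbar (@Yn C (Fbar F)).

Lemma Y_SF_module : is_module Y_SF.
Proof.
apply: transport_module (adjoint_module _).
- exact: SF_to_Fbar_lin.
- exact: Fbar_to_SF_lin.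
- exact: SF_to_Fbar_par.
- exact: Fbar_to_SF_par.
- exact: SF_to_FbarK.
- exact: Fbar_to_SFK.
Qed.

Lemma Y_Fbar_module : is_module Y_Fbar.
Proof.
apply: transport_module (adjoint_module _).
- exact: Fbar_to_SF_lin.
- exact: SF_to_Fbar_lin.
- exact: Fbar_to_SF_par.
- exact: SF_to_Fbar_par.
- exact: Fbar_to_SFK.
- exact: SF_to_FbarK.
Qed.

(** * Explicit formulas for the transported fields *)

Lemma sqrtC2_neq0 : sqrtC 2 != 0 :> C.
Proof. by rewrite sqrtC_eq0 pnatr_eq0. Qed.

(** Makes the coefficient identities linear in [sqrtC 2], so that [field] can close them without
    knowing its square. *)
Lemma sqrtC2V : (sqrtC 2)^-1 = sqrtC 2 / 2 :> C.
Proof.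
apply: (mulfI sqrtC2_neq0); rewrite mulfV ?sqrtC2_neq0 //.
by rewrite mulrA -expr2 sqrtCK mulfV ?pnatr_eq0.
Qed.

(** Conjugation gives [psim n - (2n+1) psip n]; in the basis [Phi1], [Phi2] the coefficients are -2n
    and -2i(n+1), divided by the root of 2. *)
Lemma Y_SF_a_plus : Y_SF (a_plus F) = @phi_plus _ F.
Proof.
apply/funext => n; apply/funext => v; apply: val_inj => /=.
rewrite twist_psim twist_NK mul1r /phi_plus_F psim_mode psip_mode sqrtC2V.
rewrite !scalerDr !scalerN !scalerA opprD addrACA -!scaleNr -!scalerDl.
by rewrite !rmorphD rmorphM /=; congr (_ *: _ + _ *: _); field.
Qed.

Lemma Y_SF_a_minus : Y_SF (a_minus F) = @phi_minus _ F.
Proof.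
apply/funext => n; apply/funext => v; apply: val_inj => /=.
rewrite DPsi_plus_mode (linear_scale (twist_lin _)) twist_psip twist_NK.
by rewrite /phi_minus_F psip_mode scalerA mulNr.
Qed.

(** The twist adds u to the conformal vector, giving psip_(-2) (Psi^- + Psi^+), and Psi^- + Psi^+ is
    [sqrtC 2 *: Phi1]. *)
Lemma Y_SF_omega_sf : Y_SF (omega_sf F) = Yn (omega F).
Proof.
apply/funext => n; apply/funext => v; apply: val_inj => /=.
rewrite -[X in psip (-2) X]modeE twist_omega_sf twist_NK scale1r -(module_addl YF).
congr (Yn _ n _); rewrite /psip_quad -(module_addr YF) psip_mode.
have -> : Psi_minus F + Psi_plus F = sqrtC 2 *: Phi1 F.
  rewrite /Psi_minus /Psi_plus -scalerDr addrCA [in X in _ *: X]subrK -mulr2n.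
  by rewrite -scaler_nat scalerA sqrtC2V mulfVK ?pnatr_eq0.
rewrite !(module_scaler YF) scalerDr !scalerA mulrAC !(mulVf sqrtC2_neq0).
by rewrite mul1r scale1r addrC -!modeE.
Qed.

Lemma val_scale (a : F) (ha : par true a) (c : C) (v : kerVSA ha) :
  val (c *: v) = c *: val v.
Proof. exact: ker_valZ. Qed.

Lemma val_add (a : F) (ha : par true a) (v w : kerVSA ha) :
  val (v + w) = val v + val w.
Proof. exact: (raddfD (val : ker_type a -> F)). Qed.

Lemma val_a_comb n (v : SF F) :
  val (a_comb n v) = psim n (val v) + ((n + 1) * 2)%:~R *: psip n (val v).
Proof.
rewrite /a_comb /mulz -scaleNr val_add val_scale /= DPsi_plus_mode scalerA addrK.
by rewrite mulrNN rmorphM mulrC.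
Qed.

Lemma Y_Fbar_Phi1 : Y_Fbar (Phi1_Fbar F) =
  fun n (v : SF F) => (sqrtC 2)^-1 *: a_comb n v.
Proof.
apply/funext => n; apply/funext => v; apply: val_inj.
rewrite val_scale val_a_comb /= Phi1_mode (linear_scale (twist_lin _)).
rewrite -[psip n _]scale1r twist_lin twist_psip twist_psim twistK !scale1r.
rewrite addrCA -[X in X - _]scale1r -scalerBl; congr (_ *: (_ + _ *: _)).
by rewrite !(rmorphD, rmorphM) /=; ring.
Qed.

(** Conjugation sends Phi_2(z) to i / sqrt 2 times [a_comb] minus 2 Psi^+(z); differentiating turns
    Psi^+ into a^-. *)
Lemma Y_Fbar_DPhi2 : Y_Fbar (DPhi2_Fbar F) = fun n (v : SF F) =>
  - (sqrtC 2 * 'i) *: Yn (a_minus F) n v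
  + ('i / sqrtC 2) *: derz (@a_comb _ F) n v.
Proof.
apply/funext => n; apply/funext => v; apply: val_inj.
rewrite val_add !val_scale val_a_comb /= (module_der YF _ _ (Phi_odd F 1)).
rewrite /derz Phi2_mode DPsi_plus_mode.
rewrite !(linear_scale (twist_lin _)) -scaleN1r addrC twist_lin.
rewrite twist_psip twist_psim twistK.
rewrite !(scalerDr, scalerN, scalerA, scaleN1r) sqrtC2V.
rewrite -addrA -scaleNr -scalerDl [RHS]addrCA -scalerDl.
by rewrite !(rmorphD, rmorphN, rmorphM) /=; congr (_ *: _ + _ *: _); field.
Qed.

(** Differentiation loses exactly mode -1 of Psi^+, which does not preserve SF(1); the others are
    recovered by division. *)
Lemma psip_a_minus n (v : SF F) : n != -1 ->
  psip n (val v) = val ((- (n + 1)%:~R)^-1 *: Yn (a_minus F) (n + 1) v).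
Proof.
move=> hn; rewrite val_scale /= DPsi_plus_mode addrK scalerA mulVf ?scale1r //.
by rewrite oppr_eq0 intr_eq0 -subr_eq0 opprK in hn *; lia.
Qed.

(** * Subspaces stable under the generators *)

Section StableSubspaces.
Variable U : SF F -> Prop.
Hypothesis U_sub : is_subspace U.
Hypothesis U_plus : forall n v, U v -> U (Yn (a_plus F) n v).
Hypothesis U_minus : forall n v, U v -> U (Yn (a_minus F) n v).

Let UF (x : F) := exists2 w, U w & val w = x.

Lemma UF_sub : is_subspace UF.
Proof.
have [U0 UP] := U_sub; split; first by exists 0.
move=> c _ _ [x Ux <-] [y Uy <-]; exists (c *: x + y); first exact: UP.
by rewrite val_add val_scale.
Qed.

Lemma UF_psim n x : UF x -> UF (psim n x).
Proof. by move=> [w Uw <-]; exists (Yn (a_plus F) n w) => //; apply: U_plus. Qed.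

Lemma UF_psip n x : n != -1 -> UF x -> UF (psip n x).
Proof.
move=> hn [w Uw <-]; rewrite psip_a_minus //; eexists; last by [].
by apply: subspaceZ => //; apply: U_minus.
Qed.

Lemma UF_val (v : SF F) : UF (val v) -> U v.
Proof. by move=> [w Uw /val_inj <-]. Qed.

Lemma SF_stable_full : U vac -> forall v, U v.
Proof.
move=> Uvac v; apply: UF_val; apply: ker_psim0_span => //.
- exact: UF_sub.
- by exists vac.
- exact: UF_psip.
- exact: UF_psim.
- by have := valP v; rewrite unfold_in => /eqP.
Qed.

(** The vacuum is reached by annihilators alone, and the exceptional mode -1 of [psip] is a
    creator. *)
Lemma SF_stable_vac : (exists2 v, U v & v <> 0) -> U vac.
Proof.
move=> [v Uv nzv]; apply: UF_val; apply: annihilators_reach_vac.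
- exact: UF_sub.
- by move=> n x hn; apply: UF_psip; lia.
- by move=> n x _; apply: UF_psim.
- exists (val v); first by exists v.
  by move=> e; apply: nzv; apply: val_inj.
Qed.

End StableSubspaces.

Definition a_set (a : SF F) := a = a_plus F \/ a = a_minus F.
Definition Phi_set (a : Fbar F) := a = Phi1_Fbar F \/ a = DPhi2_Fbar F.

Lemma Dop_par p (b : F) : par p b -> par p (Dop b).
Proof.
by move=> pb; have [_ h _] := Yn_field pb; rewrite -[p]addbF; apply: h; apply: vac_even.
Qed.

Lemma a_set_odd a : a_set a -> par true a.
Proof. by case=> ->; [apply: Psi_minus_odd | apply: Dop_par; apply: psip_odd]. Qed.

Lemma Phi_set_odd a : Phi_set a -> par true a.
Proof. by case=> ->; [apply: Phi_odd | apply: Dop_par; apply: Phi_odd]. Qed.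

Lemma SF_generated : strongly_generated a_set.
Proof.
move=> U hU Uvac stU; apply: SF_stable_full => // n v Uv; apply: stU => //.
  by left.
by right.
Qed.

(* phi^+ and phi^- are combinations of the modes of Phi_1 and D Phi_2, so that
   stability under the latter pulls back to stability under a^+ and a^-. *)
Section StableSubspacesFbar.
Variable U : Fbar F -> Prop.
Hypothesis U_sub : is_subspace U.
Hypothesis U_stable : forall a n v, Phi_set a -> U v -> U (Yn a n v).

Lemma Fbar_stable_phi_minus n v : U v -> U (phi_minus n v).
Proof.
move=> Uv.
have -> : phi_minus n v = - (sqrtC 2)^-1 *:
    (n%:~R *: Yn (Phi1_Fbar F) (n - 1) v - 'i *: Yn (DPhi2_Fbar F) n v).
  apply: val_inj; rewrite val_scale -scaleNr val_add !val_scale /=.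
  rewrite (module_der YF _ _ (Phi_odd F 1)) /derz /phi_minus_F !scalerDr !scalerA.
  congr (_ *: _ + _ *: _); first by rewrite mulNr mulrC.
  by rewrite mulrNz; ring.
apply: subspaceZ => //; apply: subspaceB => //; apply: subspaceZ => //.
  by apply: U_stable => //; left.
by apply: U_stable => //; right.
Qed.

Lemma Fbar_stable_phi_plus n v : U v -> U (phi_plus n v).
Proof.
move=> Uv.
(* Mode n+1 of [DPhi2_Fbar] is -(n+1) times mode n of [Phi2], which supplies the factor n+1 of
   [phi_plus]. *)
have -> : phi_plus n v = - sqrtC 2 *:
    (n%:~R *: Yn (Phi1_Fbar F) n v - 'i *: Yn (DPhi2_Fbar F) (n + 1) v).
  apply: val_inj; rewrite val_scale -scaleNr val_add !val_scale /=.
  rewrite (module_der YF _ _ (Phi_odd F 1)) /derz /phi_plus_F addrK !scalerA.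
  by congr (_ *: (_ + _ *: _)); rewrite mulrNz mulrNN.
apply: subspaceZ => //; apply: subspaceB => //; apply: subspaceZ => //.
  by apply: U_stable => //; left.
by apply: U_stable => //; right.
Qed.

Let V v := U (SF_to_Fbar v).

Lemma pullback_sub : is_subspace V.
Proof.
have [U0 UP] := U_sub; split; first by rewrite /V (linear_0 SF_to_Fbar_lin).
by move=> c x y Vx Vy; rewrite /V SF_to_Fbar_lin; apply: UP.
Qed.

Lemma pullback_plus n v : V v -> V (Yn (a_plus F) n v).
Proof.
rewrite /V => /(Fbar_stable_phi_plus n).
by rewrite -Y_SF_a_plus /Y_SF /transport SF_to_FbarK.
Qed.

Lemma pullback_minus n v : V v -> V (Yn (a_minus F) n v).
Proof.
rewrite /V => /(Fbar_stable_phi_minus n).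
by rewrite -Y_SF_a_minus /Y_SF /transport SF_to_FbarK.
Qed.

Lemma Fbar_stable_full : U vac -> forall v, U v.
Proof.
move=> Uvac v; rewrite -[v]Fbar_to_SFK.
apply: (SF_stable_full pullback_sub pullback_plus pullback_minus).
by rewrite /V SF_to_Fbar_vac.
Qed.

Lemma Fbar_stable_vac : (exists2 v, U v & v <> 0) -> U vac.
Proof.
move=> [v Uv nzv]; rewrite -SF_to_Fbar_vac.
apply: (SF_stable_vac pullback_sub pullback_plus pullback_minus).
exists (Fbar_to_SF v); first by rewrite /V Fbar_to_SFK.
by move=> e; apply: nzv; rewrite -[v]Fbar_to_SFK e (linear_0 SF_to_Fbar_lin).
Qed.

End StableSubspacesFbar.

Lemma Fbar_generated : strongly_generated Phi_set.
Proof. by move=> U hU Uvac stU; apply: Fbar_stable_full. Qed.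

Lemma ker_vac_neq0 (a : F) (ha : par true a) : vac <> 0 :> kerVSA ha.
Proof. by move=> /(congr1 val); apply: Phi_nontrivial. Qed.

Lemma SF_irreducible : is_irreducible (@Yn C (SF F)).
Proof.
apply: (adjoint_irreducible SF_generated); first exact: ker_vac_neq0.
move=> U hU stU; apply: SF_stable_vac => // n v Uv; apply: stU => //.
  by left.
by right.
Qed.

Lemma Fbar_irreducible : is_irreducible (@Yn C (Fbar F)).
Proof.
apply: (adjoint_irreducible Fbar_generated); first exact: ker_vac_neq0.
by move=> U hU stU; apply: Fbar_stable_vac.
Qed.

Lemma Y_SF_irreducible : is_irreducible Y_SF.
Proof.
apply: transport_irreducible SF_irreducible.
- exact: SF_to_Fbar_lin.
- exact: Fbar_to_SF_lin.
- exact: SF_to_FbarK.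
- exact: Fbar_to_SFK.
Qed.

Lemma Y_Fbar_irreducible : is_irreducible Y_Fbar.
Proof.
apply: transport_irreducible Fbar_irreducible.
- exact: Fbar_to_SF_lin.
- exact: SF_to_Fbar_lin.
- exact: Fbar_to_SFK.
- exact: SF_to_FbarK.
Qed.

(** * The vertex superalgebra of fields generated by phi^+ and phi^-, and locality *)

Lemma Y_SF_injective : injective Y_SF.
Proof.
move=> a b /(congr1 (fun Y => Y (-1) vac)).
rewrite /Y_SF /transport Fbar_to_SF_vac !Yn_creation //.
exact: (can_inj SF_to_FbarK).
Qed.

Lemma Y_SF_nprod p q (a b : SF F) n : par p a -> par q b ->
  Y_SF (Yn a n b) = nprod p q n (Y_SF a) (Y_SF b).
Proof.
move=> pa pb; apply/funext => k; apply/funext => v.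
exact: (module_nprod Y_SF_module).
Qed.

Lemma phi_fieldsP p (A : modes (Fbar F)) : phi_fields p A ->
  p = true /\ exists2 a, a_set a & Y_SF a = A.
Proof.
case=> -> [->|->]; split => //.
- by exists (a_plus F); [left | exact: Y_SF_a_plus].
- by exists (a_minus F); [right | exact: Y_SF_a_minus].
Qed.

Lemma a_set_phi_fields a : a_set a -> phi_fields true (Y_SF a).
Proof. by case=> ->; split => //; rewrite ?Y_SF_a_plus ?Y_SF_a_minus; auto. Qed.

Lemma Y_SF_generated_fields p (A : modes (Fbar F)) :
  gen_fields (@phi_fields _ F) p A <-> exists2 a, par p a & Y_SF a = A.
Proof.
split.
- elim=> {p A} [|p A hA|p c A B _ [a pa <-] _ [b pb <-]|
    p q n A B _ [a pa <-] _ [b pb <-]].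
  + exists vac; first exact: vac_even.
    by apply/funext => n; apply/funext => v; have [_ _ -> _] := Y_SF_module.
  + by have [-> [a ha <-]] := phi_fieldsP hA; exists a => //; apply: a_set_odd.
  + exists (c *: a + b); first exact: par_lin.
    by apply/funext => n; apply/funext => v; rewrite (module_linl Y_SF_module).
  + exists (Yn a n b); first by have [_ h _] := Yn_field pa; apply: h.
    exact: Y_SF_nprod.
move=> [a pa <-]; move: p a pa.
apply: (strongly_generated_ind a_set_odd SF_generated).
- have -> : Y_SF vac = id_field; last exact: gen_fields_id.
  by apply/funext => n; apply/funext => v; have [_ _ -> _] := Y_SF_module.
- have -> : Y_SF 0 = fun n v => -1 *: id_field n v + id_field n v.
    apply/funext => n; apply/funext => v.
    by rewrite (module_0l Y_SF_module) scaleN1r addNr.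
  by apply: gen_fields_lin; exact: gen_fields_id.
(* Zero as an odd field has to come from an odd generator, since [id_field] only gives the even
   one. *)
- have -> : Y_SF 0 = fun n v => -1 *: Y_SF (a_plus F) n v + Y_SF (a_plus F) n v.
    apply/funext => n; apply/funext => v.
    by rewrite (module_0l Y_SF_module) scaleN1r addNr.
  by apply: gen_fields_lin; apply: gen_fields_in; apply: a_set_phi_fields; left.
- move=> p c a b ha hb.
  have -> : Y_SF (c *: a + b) = fun n v => c *: Y_SF a n v + Y_SF b n v.
    by apply/funext => n; apply/funext => v; rewrite (module_linl Y_SF_module).
  exact: gen_fields_lin.
- move=> p a n b Sa pb hb; rewrite (Y_SF_nprod _ (a_set_odd Sa) pb) -addTb.
  by apply: gen_fields_nprod => //; apply: gen_fields_in; apply: a_set_phi_fields.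
Qed.

Lemma Y_SF_generated_vsa : is_generated_vsa (@phi_fields _ F) Y_SF.
Proof.
split.
- by move=> c a b n v; rewrite (module_linl Y_SF_module).
- exact: Y_SF_injective.
- exact: Y_SF_generated_fields.
- by apply/funext => n; apply/funext => v; have [_ _ -> _] := Y_SF_module.
- by move=> p q a b n; apply: Y_SF_nprod.
Qed.

(* [(z - w)^2] kills the second difference of a function linear in m. *)
Lemma linear_anticommutator_local (M : superSpace C) (A B : modes M) (c : C) :
    (forall m n v, A m (B n v) + B n (A m v)
       = if m + n == 0 then (c * m%:~R) *: v else 0) ->
  mutually_local true true A B.
Proof.
move=> h; exists 2%N => m n v.
rewrite !big_ord_recl big_ord0 /= /bump /= /psign /= expr1 !scaleN1r !opprK !h.
have -> : m + 1%N%:Z + (n + 1%N%:Z) = m + 2%N%:Z + (n + 0%N%:Z) by lia.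
have -> : m + 0%N%:Z + (n + 2%N%:Z) = m + 2%N%:Z + (n + 0%N%:Z) by lia.
case: ifP => _; last by rewrite !scaler0 !addr0.
rewrite !scalerA addr0 -!scalerDl !rmorphD /=.
rewrite -[RHS](scale0r v) !addn0 bin0 bin1 binn subn0; congr (_ *: _).
by rewrite /= !subSS !subn0 -!pmulrn; ring.
Qed.

(** These are the symplectic fermion relations: c is the skew form on a^+, a^-, with values 0, 1,
    -1, 0. *)
Lemma a_anticommutator a b : a_set a -> a_set b -> exists c : C,
  forall m n (v : SF F), Yn a m (Yn b n v) + Yn b n (Yn a m v)
    = if m + n == 0 then (c * m%:~R) *: v else 0.
Proof.
have pm m n (v : SF F) :
    Yn (a_plus F) m (Yn (a_minus F) n v) + Yn (a_minus F) n (Yn (a_plus F) m v)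
    = if m + n == 0 then m%:~R *: v else 0.
  apply: val_inj; rewrite val_add /= !DPsi_plus_mode (module_scaler YF) psim_psip.
  rewrite -scalerDr subrK addrA subrK.
  case: ifP => [/eqP e|_]; last by rewrite scaler0.
  by rewrite val_scale (_ : m = - n) ?mulrNz //; lia.
case=> -> [] ->.
- exists 0 => m n v; rewrite mul0r scale0r if_same.
  by apply: val_inj; rewrite val_add /= psim_psim addNr.
- by exists 1 => m n v; rewrite mul1r pm.
(* Swapping the fields swaps m and n, and n = -m on the support. *)
- exists (-1) => m n v; rewrite addrC pm [n + m]addrC mulN1r.
  by case: eqP => // e; rewrite (_ : m = - n) ?mulrNz ?opprK //; lia.
- exists 0 => m n v; rewrite mul0r scale0r if_same; apply: val_inj.
  rewrite val_add /= !DPsi_plus_mode !(module_scaler YF) psip_psip !scalerN.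
  by rewrite !scalerA mulrC addNr.
Qed.

Lemma phi_fields_local p q (A B : modes (Fbar F)) :
  phi_fields p A -> phi_fields q B -> is_field p A /\ mutually_local p q A B.
Proof.
move=> /phi_fieldsP[-> [a ha <-]] /phi_fieldsP[-> [b hb <-]].
split; first by have [_ h _ _] := Y_SF_module; apply: h; apply: a_set_odd.
have [c hc] := a_anticommutator ha hb.
apply: (linear_anticommutator_local (c := c)) => m n v.
rewrite /Y_SF /transport !SF_to_FbarK -[SF_to_Fbar _]scale1r -SF_to_Fbar_lin.
rewrite scale1r hc; case: ifP => _; last exact: linear_0 SF_to_Fbar_lin.
by rewrite (linear_scale SF_to_Fbar_lin) Fbar_to_SFK.
Qed.

End Isomorphism.

Theorem proposition3p4 (R : realType) (F : cliffordVSA R[i]) :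
  (* (1) *)
  ((forall p q (A B : modes (Fbar F)), phi_fields p A -> phi_fields q B ->
      is_field p A /\ mutually_local p q A B) /\
   exists (W : vertexSuperalgebra R[i]) (iota : W -> modes (Fbar F)),
     is_generated_vsa (@phi_fields _ F) iota /\ vsa_isomorphic W (SF F)) /\
  (* (2) *)
  (exists Y : SF F -> modes (Fbar F),
     [/\ is_module Y,
         Y (a_plus F) = @phi_plus _ F /\ Y (a_minus F) = @phi_minus _ F,
         forall Y' : SF F -> modes (Fbar F), is_module Y' ->
           Y' (a_plus F) = @phi_plus _ F -> Y' (a_minus F) = @phi_minus _ F ->
           Y' = Y,
         is_irreducible Y &
         Y (omega_sf F) = Yn (omega F)]) /\
  (* (3) *)
  (exists Y : Fbar F -> modes (SF F),
     let Phi1_field : modes (SF F) :=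
       fun n v => (sqrtC 2)^-1 *: a_comb n v in
     let DPhi2_field : modes (SF F) :=
       fun n v => - (sqrtC 2 * 'i) *: Yn (a_minus F) n v
                  + ('i / sqrtC 2) *: derz (@a_comb _ F) n v in
     [/\ is_module Y,
         Y (Phi1_Fbar F) = Phi1_field /\ Y (DPhi2_Fbar F) = DPhi2_field,
         forall Y' : Fbar F -> modes (SF F), is_module Y' ->
           Y' (Phi1_Fbar F) = Phi1_field -> Y' (DPhi2_Fbar F) = DPhi2_field ->
           Y' = Y &
         is_irreducible Y]).
Proof.
split; last split.
- split; first exact: phi_fields_local.
  (* [SF F] itself serves as the algebra of fields, embedded by [Y_SF], so the isomorphism is the
     identity. *)
  exists (SF F), (@Y_SF _ F); split; first exact: Y_SF_generated_vsa.
  by exists id; split => //; exists id.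
- exists (@Y_SF _ F); split.
  + exact: Y_SF_module.
  + by split; [exact: Y_SF_a_plus | exact: Y_SF_a_minus].
  + move=> Y' modY' plus minus.
    apply: (module_unique (@a_set_odd _ F) (@SF_generated _ F)
      (@Y_SF_module _ F)) => // a.
    by case=> ->; rewrite ?plus ?minus ?Y_SF_a_plus ?Y_SF_a_minus.
  + exact: Y_SF_irreducible.
  + exact: Y_SF_omega_sf.
- exists (@Y_Fbar _ F) => Phi1_field DPhi2_field; split.
  + exact: Y_Fbar_module.
  + by split; [exact: Y_Fbar_Phi1 | exact: Y_Fbar_DPhi2].
  + move=> Y' modY' e1 e2.
    apply: (module_unique (@Phi_set_odd _ F) (@Fbar_generated _ F)
      (@Y_Fbar_module _ F)) => // a.
    by case=> ->; rewrite ?e1 ?e2 ?Y_Fbar_Phi1 ?Y_Fbar_DPhi2.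
  + exact: Y_Fbar_irreducible.
Qed.
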